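(* Let $n\ge2$ be finite. Any strongly maximal triangular subalgebra of the canonical UHF subalgebra $A(P_{UHF})$ of $O_n$ with diagonal $A(D_0)$ is contained in a strongly maximal triangular subalgebra of $O_n$ with the same diagonal $A(D_0)$.
   Context: Fix a finite $n\ge 2$. $X=\prod_{1}^{\infty}\{1,\dots,n\}$ with the product topology. For a (possibly empty) finite string $\alpha$ in $\{1,\dots,n\}$, $\ell(\alpha)$ is its length, and $\alpha\gamma$ ($\gamma\in X$) is the concatenation. The Cuntz groupoid is $G_n=\{(\alpha\gamma,\ell(\alpha)-\ell(\beta),\beta\gamma)\mid \alpha,\beta \text{ finite strings},\ \gamma\in X\}$ with $(x,k,y)(y,j,z)=(x,k+j,z)$, $(x,k,y)^{-1}=(y,-k,x)$, and topology with basis the (compact open) sets $U_{\alpha,\beta}=\{(\alpha\gamma,\ell(\alpha)-\ell(\beta),\beta\gamma)\mid\gamma\in X\}$. The groupoid C*-algebra $C^*(G_n)$ is the completion of $C_c(G_n)$ (with convolution $f*g(x,k,y)=\sum f(x,k_1,z)g(z,k_2,y)$, the sum over $k_1+k_2=k$ and $z$ with both factors in $G_n$, and $f^*(x,k,y)=\overline{f(y,-k,x)}$) in the groupoid C*-norm. The Cuntz algebra $O_n$, generated by isometries $S_1,\dots,S_n$ with $\sum S_iS_i^*=I$, is identified with $C^*(G_n)$ so that $S_\alpha S_\beta^*$ (where $S_\alpha=S_{\alpha_1}\cdots S_{\alpha_k}$, $S_\emptyset=I$) corresponds to the characteristic function $\chi_{\alpha,\beta}$ of $U_{\alpha,\beta}$.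 Since the sup norm is dominated by the C*-norm, elements of $C^*(G_n)$ are viewed as continuous functions on $G_n$ vanishing at infinity. For an open $P\subseteq G_n$, $A(P)=\{f\in C^*(G_n)\mid f \text{ vanishes on } G_n\setminus P\}$. $D_0=\{(x,0,x)\mid x\in X\}$ and $P_{UHF}=\{(x,k,y)\in G_n\mid k=0\}$. $A(P_{UHF})$, the canonical UHF subalgebra, is generated by the $S_\alpha S_\beta^*$ with $\ell(\alpha)=\ell(\beta)$ and is an $n^\infty$-UHF algebra. For $C=A(P_{UHF})$ or $C=O_n$, a norm closed subalgebra $T\subseteq C$ is triangular with diagonal $A(D_0)$ if $T\cap T^*=A(D_0)$; it is strongly maximal triangular if in addition $T+T^*$ is norm dense in $C$. *)

(* Defs.v *)
From HB Require Import structures.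
From mathcomp Require Import all_boot all_order all_algebra sesquilinear.
From mathcomp Require Import complex zify.
From mathcomp Require Import all_classical all_reals all_analysis.

Set Implicit Arguments.
Unset Strict Implicit.
Unset Printing Implicit Defensive.

Import Order.TTheory GRing.Theory Num.Theory numFieldNormedType.Exports.
Local Open Scope classical_set_scope.
Local Open Scope ring_scope.
Local Open Scope complex_scope.

(* R[i] carries no topology in the library; this is the one given by its
   modulus. *)
HB.instance Definition _ (R : realType) := NormedModule.copy R[i] (R[i])^o.

(* One-sided infinite words, indexed from 0. *)
Definition path_space (n : nat) : Type :=
  prod_topology (fun _ : nat => discrete_topology 'I_n).

HB.instance Definition _ n := Topological.on (path_space n).

(* alpha gamma; when k >= size alpha, nth returns its default. *)
Definition concat (n : nat) (alpha : seq 'I_n) (gamma : path_space n) :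
  path_space n := fun k => nth (gamma (k - size alpha)%N) alpha k.

Record cuntz_groupoid (n : nat) : Type := CuntzGroupoid {
  cg_range : path_space n;
  cg_degree : int;
  cg_source : path_space n;
  cg_spec : exists (alpha beta : seq 'I_n) (gamma : path_space n),
    [/\ cg_range = concat alpha gamma,
        cg_degree = (size alpha)%:Z - (size beta)%:Z
      & cg_source = concat beta gamma] }.

HB.instance Definition _ n := gen_eqMixin (cuntz_groupoid n).
HB.instance Definition _ n := gen_choiceMixin (cuntz_groupoid n).

Definition cg_basic (n : nat) (alpha beta : seq 'I_n) : set (cuntz_groupoid n) :=
  [set g | exists gamma : path_space n,
    [/\ cg_range g = concat alpha gamma,
        cg_degree g = (size alpha)%:Z - (size beta)%:Z
      & cg_source g = concat beta gamma] ].

Lemma concat_cat n (a b : seq 'I_n) (x : path_space n) :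
  concat (a ++ b) x = concat a (concat b x).
Proof.
apply/funext => k; rewrite /concat nth_cat size_cat subnDA.
case: ltnP => ka; first exact: set_nth_default.
by rewrite [RHS]nth_default.
Qed.

Lemma concat_prefix n (a b : seq 'I_n) (x y : path_space n) :
  (size a <= size b)%N -> concat a x = concat b y ->
  exists2 d, b = a ++ d & x = concat d y.
Proof.
move=> ab E; have Ek k : concat a x k = concat b y k by rewrite E.
have tE : take (size a) b = a.
  apply: (@eq_from_nth _ (x 0%N)); first by rewrite size_takel.
  move=> k; rewrite size_takel // => ka; rewrite nth_take //.
  have := Ek k; rewrite /concat (set_nth_default (x 0%N)) // => ->.
  by apply: set_nth_default; exact: leq_trans ab.
exists (drop (size a) b); first by rewrite -{1}tE cat_take_drop.
apply/funext => k; have := Ek (size a + k)%N.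
rewrite /concat nth_default ?leq_addr // addKn => ->.
by rewrite nth_drop size_drop subnBA // addnC.
Qed.

Lemma concat_inj n (a b : seq 'I_n) (x : path_space n) :
  size a = size b -> concat a x = concat b x -> a = b.
Proof.
move=> ab /concat_prefix -/(_ _)[|d bE _]; first by rewrite ab.
have := congr1 size bE; rewrite size_cat ab => /eqP.
by rewrite -[X in X == _]addn0 eqn_add2l eq_sym size_eq0 => /eqP d0;
  rewrite bE d0 cats0.
Qed.

Lemma cg_basic_sub n (a b a' b' : seq 'I_n) (g : cuntz_groupoid n) :
  (size a <= size a')%N -> cg_basic a b g -> cg_basic a' b' g ->
  cg_basic a' b' `<=` cg_basic a b.
Proof.
move=> aa' [x [gr gd gs]] [y [gr' gd' gs']].
have [d a'E xE] : exists2 d, a' = a ++ d & x = concat d y.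
  by apply: concat_prefix; rewrite // -gr.
have sE : size b' = (size b + size d)%N.
  by move: gd'; rewrite gd a'E size_cat; lia.
have [d' b'E xE'] : exists2 d', b' = b ++ d' & x = concat d' y.
  by apply: concat_prefix; rewrite -?gs // sE leq_addr.
have dd' : d = d'.
  apply: (@concat_inj _ _ _ y); last by rewrite -xE.
  by move: sE; rewrite b'E size_cat => /addnI.
move=> h [z [hr hd hs]]; exists (concat d z); split.
- by rewrite hr a'E concat_cat.
- by rewrite hd -gd' gd.
- by rewrite hs b'E -dd' concat_cat.
Qed.

Lemma cg_basic_cover n :
  \bigcup_(i in setT) cg_basic i.1 i.2 = [set: cuntz_groupoid n].
Proof.
apply/seteqP; split => // -[x k y [a [b [z h]]]] _.
by exists (a, b) => //; exists z.
Qed.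

Lemma cg_basic_join n (i j : seq 'I_n * seq 'I_n) (g : cuntz_groupoid n) :
  setT i -> setT j -> cg_basic i.1 i.2 g -> cg_basic j.1 j.2 g ->
  exists k, [/\ setT k, cg_basic k.1 k.2 g
    & cg_basic k.1 k.2 `<=` cg_basic i.1 i.2 `&` cg_basic j.1 j.2].
Proof.
move=> _ _ gi gj; case/orP: (leq_total (size i.1) (size j.1)) => ij.
  by exists j; split=> // h hj; split=> //; exact: cg_basic_sub gj _ hj.
by exists i; split=> // h hi; split=> //; exact: cg_basic_sub gi _ hi.
Qed.

HB.instance Definition _ n := isPointed.Build (seq 'I_n) [::].
HB.instance Definition _ n := isBaseTopological.Build (cuntz_groupoid n)
  (@cg_basic_cover n) (@cg_basic_join n).

Lemma cg_inv_spec n (g : cuntz_groupoid n) :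
  exists (alpha beta : seq 'I_n) (gamma : path_space n),
    [/\ cg_source g = concat alpha gamma,
        - cg_degree g = (size alpha)%:Z - (size beta)%:Z
      & cg_range g = concat beta gamma].
Proof.
by have [a [b [z [? -> ?]]]] := cg_spec g; exists b, a, z; rewrite opprB.
Qed.

Definition cg_inv (n : nat) (g : cuntz_groupoid n) : cuntz_groupoid n :=
  CuntzGroupoid (cg_inv_spec g).

(* (g, h) is composable with product c; products of elements of the groupoid
   always lie in it, so this is the graph of its multiplication. *)
Definition cg_mul_to (n : nat) (c g h : cuntz_groupoid n) : Prop :=
  [/\ cg_source g = cg_range h, cg_range c = cg_range g,
      cg_degree c = cg_degree g + cg_degree h & cg_source c = cg_source h].

Definition P_UHF (n : nat) : set (cuntz_groupoid n) :=
  [set g | cg_degree g = 0].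

Definition D_0 (n : nat) : set (cuntz_groupoid n) :=
  [set g | cg_degree g = 0 /\ cg_range g = cg_source g].

Definition Cc (R : realType) (n : nat) : set (cuntz_groupoid n -> R[i]) :=
  [set f | continuous f /\ compact (closure [set g | f g != 0])].

(* For f and g in Cc only finitely many terms are nonzero. *)
Definition conv (R : realType) (n : nat) (f g : cuntz_groupoid n -> R[i]) :
    cuntz_groupoid n -> R[i] :=
  fun c => \sum_(p \in [set p | cg_mul_to c p.1 p.2]) f p.1 * g p.2.

Definition conv_star (R : realType) (n : nat) (f : cuntz_groupoid n -> R[i]) :
    cuntz_groupoid n -> R[i] :=
  fun g => (f (cg_inv g))^*.

(* Unital C*-algebras, to be used with K = R[i].  The multiplication is part of
   the mixin because the library's hierarchy has no join of rings and normed
   modules. *)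
HB.mixin Record isCstarAlgebra (K : numClosedFieldType) A
    & CompleteNormedModule K A := {
  cone : A;
  cmul : A -> A -> A;
  star : A -> A;
  cmulA : associative cmul;
  cmul1a : left_id cone cmul;
  cmula1 : right_id cone cmul;
  cmulDl : left_distributive cmul +%R;
  cmulDr : right_distributive cmul +%R;
  cmulZl : forall (c : K) (a b : A), cmul (c *: a) b = c *: cmul a b;
  cmulZr : forall (c : K) (a b : A), cmul a (c *: b) = c *: cmul a b;
  starK : involutive star;
  starD : {morph star : a b / a + b};
  starZ : forall (c : K) (a : A), star (c *: a) = Num.conj c *: star a;
  starM : forall a b : A, star (cmul a b) = cmul (star b) (star a);
  ler_norm_cmul : forall a b : A, `|cmul a b| <= `|a| * `|b|;
  cstar_normE : forall a : A, `|cmul (star a) a| = `|a| ^+ 2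
}.

#[short(type="cstarAlgType")]
HB.structure Definition CstarAlgebra (K : numClosedFieldType) :=
  {A of CompleteNormedModule K A & isCstarAlgebra K A}.

Declare Scope cstar_scope.
Delimit Scope cstar_scope with cstar.
Notation "1" := (@cone _ _) : cstar_scope.
Notation "a * b" := (cmul a b) : cstar_scope.

(* Linear in the first variable, conjugate linear in the second. *)
Definition hilbert_product (R : realType) (H : completeNormedModType R[i])
    (ip : {dot H for Num.conj}) : Prop :=
  forall xi : H, ip xi xi = `|xi| ^+ 2.

Definition bounded_operator (R : realType) (H : completeNormedModType R[i])
    (u : H -> H) : Prop :=
  (forall (c : R[i]) (xi eta : H), u (c *: xi + eta) = c *: u xi + u eta) /\
  exists M : R[i], forall xi : H, `|u xi| <= M * `|xi|.

Definition Cc_representation (R : realType) (n : nat)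
    (H : completeNormedModType R[i]) (ip : {dot H for Num.conj})
    (pi : (cuntz_groupoid n -> R[i]) -> H -> H) : Prop :=
  [/\ forall f, @Cc R n f -> bounded_operator (pi f),
      forall (c : R[i]) f g, @Cc R n f -> @Cc R n g ->
        forall xi, pi (c *: f + g) xi = c *: pi f xi + pi g xi,
      forall f g, @Cc R n f -> @Cc R n g ->
        forall xi, pi (conv f g) xi = pi f (pi g xi)
    & forall f, @Cc R n f ->
        forall xi eta, ip (pi f xi) eta = ip xi (pi (conv_star f) eta)].

(* The full C*-norm: the supremum of the operator norms of f over all
   representations on Hilbert spaces.  For f in Cc this set is nonempty and
   bounded, the groupoid being etale. *)
Definition groupoid_norm (R : realType) (n : nat)
    (f : cuntz_groupoid n -> R[i]) : R :=
  sup [set r : R | exists (H : completeNormedModType R[i])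
      (ip : {dot H for Num.conj}) (pi : (cuntz_groupoid n -> R[i]) -> H -> H)
      (xi : H),
    [/\ hilbert_product ip, Cc_representation ip pi, `|xi| <= 1
      & r%:C = `|pi f xi|] ].

(* A, with iota, is the completion of Cc in the groupoid C*-norm; the values of
   iota outside Cc play no role. *)
Definition is_groupoid_cstar_algebra (R : realType) (n : nat)
    (A : cstarAlgType R[i]) (iota : (cuntz_groupoid n -> R[i]) -> A) : Prop :=
  [/\ forall (c : R[i]) f g, @Cc R n f -> @Cc R n g ->
        iota (c *: f + g) = c *: iota f + iota g,
      forall f g, @Cc R n f -> @Cc R n g -> iota (conv f g) = (iota f * iota g)%cstar,
      forall f, @Cc R n f -> iota (conv_star f) = star (iota f),
      forall f, @Cc R n f -> `|iota f| = (groupoid_norm f)%:C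
    & closure (iota @` @Cc R n) = setT].

(* The function on the groupoid represented by a: the continuous extension to A
   of the evaluations on Cc, which are bounded since the sup norm is dominated
   by the C*-norm. *)
Definition as_function (R : realType) (n : nat) (A : cstarAlgType R[i])
    (iota : (cuntz_groupoid n -> R[i]) -> A) (a : A) (g : cuntz_groupoid n) :
    R[i] :=
  get [set z : R[i] | forall f : nat -> cuntz_groupoid n -> R[i],
    (forall k, @Cc R n (f k)) -> iota (f k) @[k --> \oo] --> a ->
    f k g @[k --> \oo] --> z].

Definition supported_in (R : realType) (n : nat) (A : cstarAlgType R[i])
    (iota : (cuntz_groupoid n -> R[i]) -> A) (P : set (cuntz_groupoid n)) :
    set A :=
  [set a | forall g, ~ P g -> as_function iota a g = 0].

Definition closed_subalgebra (K : numClosedFieldType) (A : cstarAlgType K)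
    (T : set A) : Prop :=
  [/\ closed T, T 0,
      forall (c : K) a b, T a -> T b -> T (c *: a + b)
    & forall a b, T a -> T b -> T (a * b)%cstar].

Definition triangular (K : numClosedFieldType) (A : cstarAlgType K)
    (C D T : set A) : Prop :=
  [/\ closed_subalgebra T, T `<=` C & T `&` (@star K A @` T) = D].

Definition strongly_maximal_triangular (K : numClosedFieldType)
    (A : cstarAlgType K) (C D T : set A) : Prop :=
  triangular C D T /\
  C `<=` closure [set c | exists a b, [/\ T a, T b & c = a + star b] ].

Definition is_cuntz_algebra (K : numClosedFieldType) (A : cstarAlgType K)
    (n : nat) (S : 'I_n -> A) : Prop :=
  [/\ forall i, (star (S i) * S i = 1)%cstar,
      \sum_(i < n) cmul (S i) (star (S i)) = cone
    & forall B : set A, closed_subalgebra B ->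
        (forall a, B a -> B (star a)) -> (forall i, B (S i)) -> B = setT].

Definition word_isometry (K : numClosedFieldType) (A : cstarAlgType K)
    (n : nat) (S : 'I_n -> A) (alpha : seq 'I_n) : A :=
  \big[@cmul K A / @cone K A]_(i <- alpha) S i.

(* Main.v *)
Require Import Defs.
From HB Require Import structures.
From mathcomp Require Import all_boot all_order all_algebra.
From mathcomp Require Import sesquilinear complex separable cyclotomic.
From mathcomp Require finmap.
From mathcomp Require Import ring lra zify.
From mathcomp Require Import all_classical all_reals all_analysis.

Set Implicit Arguments.
Unset Strict Implicit.
Unset Printing Implicit Defensive.
Import Order.TTheory GRing.Theory Num.Theory numFieldNormedType.Exports.
Local Open Scope classical_set_scope.
Local Open Scope ring_scope.

(** The circle acts on the Cuntz algebra by the gauge automorphisms, which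
    multiply the monomial of two words [alpha], [beta] (the product of S_alpha
    and the adjoint of S_beta) by the power of [z] with exponent
    [size alpha - size beta].  Let Phi_k be the k-th Fourier coefficient of this
    action.  The extension of [T] consists of the elements with Phi_k a = 0 for
    all k < 0 and Phi_0 a in [T] ([analytic_extension]): [T] together with
    everything of positive degree.

    - It is a closed subalgebra, since Phi_0 is multiplicative on elements
      without negative coefficients ([fourier_mul_analytic]).
    - An element which lies in it together with its adjoint has no coefficient
      but the zeroth, because Phi_k of an adjoint is the adjoint of Phi_(-k).
      Hence it equals its zeroth coefficient ([fourier_only_zero]), and it lies
      in [T] together with its adjoint, that is, in the diagonal.
    - The sum of the extension and its adjoint contains Phi_k a for k <> 0, and
      its closure contains every Phi_0 a, which lies in the UHF subalgebra,
      where [T] is strongly maximal.  The Fejer means of [a] are combinations of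
      the Phi_k a and converge to [a] ([fejer_converges]), so the sum is dense.

    The gauge action is isometric because composing a representation with it
    gives a representation ([groupoid_norm_gauge]).  On a finite combination of
    monomials the coefficients and the Fejer means are averages over roots of
    unity ([multiplier_kernel]); they extend to the algebra by continuity.

    The UHF subalgebra is given by the vanishing of functions, so one must know
    that the coefficients of an element are determined by the function it
    represents.  First, the sup norm is dominated by the C*-norm ([Cc_sup_le]),
    which makes the function of an element meaningful ([as_function_close]).
    On combinations of monomials the value at a point is a matrix entry between
    two long words.  A general element of Cc is approximated by such
    combinations, and the error is estimated one bisection at a time: if [f] is
    carried by a bisection and bounded by [M], then f^* f is a diagonal function
    d^2 with 0 <= d <= M, and the square root of M^2 - d^2 exhibits
    M^2 - f^* f as positive in every representation ([representation_bound]).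
    Second, if the function of [a] vanishes in degree [k], then Phi_k a = 0
    ([fourier_faithful]): compression by words taken far along a fixed path is
    contractive, fixes the combinations of short monomials, and only sees values
    of the function. *)

(** * Unital C*-algebras *)
HB.instance Definition _ (K : numClosedFieldType) (A : cstarAlgType K) :=
  Monoid.isLaw.Build A cone cmul cmulA cmul1a cmula1.

Section CstarBasics.
Context {K : numClosedFieldType} {A : cstarAlgType K}.
Implicit Types a b : A.

Lemma cmul0l a : cmul 0 a = 0 :> A.
Proof. by apply: (addrI (cmul 0 a)); rewrite -cmulDl !addr0. Qed.

Lemma cmul0r a : cmul a 0 = 0 :> A.
Proof. by apply: (addrI (cmul a 0)); rewrite -cmulDr !addr0. Qed.

Lemma cmulNl a b : cmul (- a) b = - cmul a b.
Proof. by apply: (addrI (cmul a b)); rewrite -cmulDl !subrr cmul0l. Qed.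

Lemma cmulNr a b : cmul a (- b) = - cmul a b.
Proof. by apply: (addrI (cmul a b)); rewrite -cmulDr !subrr cmul0r. Qed.

Lemma cmulBl a b c : cmul (a - b) c = cmul a c - cmul b c.
Proof. by rewrite cmulDl cmulNl. Qed.

Lemma cmulBr a b c : cmul c (a - b) = cmul c a - cmul c b.
Proof. by rewrite cmulDr cmulNr. Qed.

Lemma cmul_suml I (r : seq I) (P : pred I) (F : I -> A) a :
  cmul (\sum_(i <- r | P i) F i) a = \sum_(i <- r | P i) cmul (F i) a.
Proof.
by apply: (big_morph (fun x => cmul x a) (fun x y => cmulDl x y a) (cmul0l a)).
Qed.

Lemma cmul_sumr I (r : seq I) (P : pred I) (F : I -> A) a :
  cmul a (\sum_(i <- r | P i) F i) = \sum_(i <- r | P i) cmul a (F i).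
Proof. by apply: (big_morph (cmul a) (cmulDr a) (cmul0r a)). Qed.

Lemma star0 : star 0 = 0 :> A.
Proof. by apply: (addrI (star 0)); rewrite -starD !addr0. Qed.

Lemma starN a : star (- a) = - star a.
Proof. by apply: (addrI (star a)); rewrite -starD !subrr star0. Qed.

Lemma starB a b : star (a - b) = star a - star b.
Proof. by rewrite starD starN. Qed.

Lemma star_sum I (r : seq I) (P : pred I) (F : I -> A) :
  star (\sum_(i <- r | P i) F i) = \sum_(i <- r | P i) star (F i).
Proof. by apply: (big_morph (@star K A) (@starD K A) star0). Qed.

Lemma star1 : star cone = cone :> A.
Proof.
have : star (cmul (star cone) cone) = star cone :> A by rewrite starM starK cmula1.
by rewrite cmula1 starK.
Qed.

Lemma norm_star_le a : `|a| <= `|star a|.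
Proof.
have [->|a0] := eqVneq a 0; first by rewrite normr0.
by rewrite -(ler_pM2r (x := `|a|)) ?normr_gt0 // -expr2 -cstar_normE ler_norm_cmul.
Qed.

Lemma norm_star a : `|star a| = `|a|.
Proof.
apply/eqP; rewrite eq_le norm_star_le andbT.
by apply: (le_trans (norm_star_le _)); rewrite starK.
Qed.

(** An isometry has norm 1, or 0 when the algebra is trivial. *)
Lemma isometry_norm_le1 a : cmul (star a) a = cone -> `|a| <= 1.
Proof.
have sq (x : A) : `|x| ^+ 2 = `|x| -> `|x| <= 1.
  have [->|x0] := eqVneq x 0; first by rewrite normr0.
  move=> /eqP; rewrite expr2 -[X in _ == X]mulr1 => /eqP.
  by move/(mulfI _) => -> //; rewrite normr_eq0.
have c1 : `|cone : A| <= 1 by apply: sq; rewrite -cstar_normE star1 cmul1a.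
move=> aE; rewrite -(@ler_pXn2r _ 2) ?nnegrE ?normr_ge0 ?ler01 //.
by rewrite -cstar_normE aE expr1n.
Qed.

Lemma norm_cone : (cone : A) != 0 -> `|cone : A| = 1.
Proof.
move=> c0; apply: (mulfI (x := `|cone : A|)); first by rewrite normr_eq0.
by rewrite -expr2 -cstar_normE star1 cmul1a mulr1.
Qed.

Lemma norm_mul_le1l a b : `|a| <= 1 -> `|cmul a b| <= `|b|.
Proof. by move=> a1; apply: (le_trans (ler_norm_cmul _ _)); rewrite ler_piMl. Qed.

Lemma norm_mul_le1r a b : `|b| <= 1 -> `|cmul a b| <= `|a|.
Proof. by move=> a1; apply: (le_trans (ler_norm_cmul _ _)); rewrite ler_piMr. Qed.

End CstarBasics.

(** * Words in the Cuntz isometries *)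
Section CuntzWords.
Context {K : numClosedFieldType} {A : cstarAlgType K} {n : nat}.
Variables (S : 'I_n -> A).
Hypothesis Siso : forall i, cmul (star (S i)) (S i) = cone.
Hypothesis Sorth : forall i j, i != j -> cmul (star (S i)) (S j) = 0.
Hypothesis Ssum : \sum_(i < n) cmul (S i) (star (S i)) = cone.
Local Notation W := (word_isometry S).

Lemma word_nil : W [::] = cone. Proof. exact: big_nil. Qed.
Lemma word_cons i a : W (i :: a) = cmul (S i) (W a). Proof. exact: big_cons. Qed.
Lemma word_cat a b : W (a ++ b) = cmul (W a) (W b). Proof. exact: big_cat. Qed.

Lemma word_iso a : cmul (star (W a)) (W a) = cone.
Proof.
elim: a => [|i a IH]; first by rewrite word_nil star1 cmul1a.
by rewrite word_cons starM -cmulA (cmulA (star (S i))) Siso cmul1a.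
Qed.

Lemma word_norm a : `|W a| <= 1.
Proof. exact: isometry_norm_le1 (word_iso a). Qed.

Lemma word_star_norm a : `|star (W a)| <= 1.
Proof. by rewrite norm_star word_norm. Qed.

Lemma word_orth a b : size a = size b -> a != b ->
  cmul (star (W a)) (W b) = 0.
Proof.
elim: a b => [|i a IH] [|j b] //= [sab] ab.
rewrite !word_cons starM -cmulA (cmulA (star (S i))).
have [ij|ij] := eqVneq i j; last by rewrite Sorth // cmul0l cmul0r.
rewrite ij Siso cmul1a IH //; apply: contra ab => /eqP ->.
by rewrite ij.
Qed.

(** Cuntz's reduction rule: a product of an adjoint word and a longer word is
    the remaining word if the first is a prefix of the second, else zero. *)
Lemma word_prefix a b : (size a <= size b)%N ->
  (exists2 d, b = a ++ d & cmul (star (W a)) (W b) = W d) \/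
  cmul (star (W a)) (W b) = 0.
Proof.
move=> ab; have [E|E] := eqVneq a (take (size a) b); [left|right].
  exists (drop (size a) b); first by rewrite [X in X ++ _]E cat_take_drop.
  by rewrite -{1}(cat_take_drop (size a) b) -E word_cat cmulA word_iso cmul1a.
rewrite -{1}(cat_take_drop (size a) b) word_cat cmulA word_orth ?cmul0l //.
by rewrite size_takel.
Qed.

Definition mono (p : seq 'I_n * seq 'I_n) : A := cmul (W p.1) (star (W p.2)).

Lemma mono_star p : star (mono p) = mono (p.2, p.1).
Proof. by rewrite /mono starM starK. Qed.

Definition deg (p : seq 'I_n * seq 'I_n) : int := (size p.1)%:Z - (size p.2)%:Z.

(** Monomials are closed under products up to zero, and degrees add up: this is
    what grades the algebra. *)
Lemma mono_mul p q : cmul (mono p) (mono q) = 0 \/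
  exists2 r, cmul (mono p) (mono q) = mono r & deg r = deg p + deg q.
Proof.
case: p q => [a b] [c d]; rewrite /mono /deg /=.
have -> : cmul (cmul (W a) (star (W b))) (cmul (W c) (star (W d))) =
   cmul (W a) (cmul (cmul (star (W b)) (W c)) (star (W d))) by rewrite !cmulA.
have [bc|/ltnW bc] := leqP (size b) (size c).
  case: (word_prefix bc) => [[e cE ->]|->]; last by left; rewrite cmul0l cmul0r.
  right; exists (a ++ e, d); rewrite /= ?word_cat ?cmulA //.
  by rewrite cE !size_cat; lia.
case: (word_prefix bc) => [[e cE]|] /(congr1 (@star K A)).
  rewrite starM starK => ->; right; exists (a, d ++ e) => /=.
    by rewrite word_cat starM.
  by rewrite cE !size_cat; lia.
by rewrite starM starK star0 => ->; left; rewrite cmul0l cmul0r.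
Qed.

(** A compression by words that extend those of the monomial is a scalar, the
    value of the indicator function of the monomial: this translates between
    the algebra and functions on the groupoid.  The monomial and the pair of
    words must have the same degree for the remaining words to have equal
    length. *)
Lemma mono_coef p mu nu (y : path_space n) (g : cuntz_groupoid n) :
  cg_range g = concat mu y -> cg_source g = concat nu y ->
  cg_degree g = deg (mu, nu) -> deg p = deg (mu, nu) ->
  (size p.1 <= size mu)%N ->
  cmul (star (W mu)) (cmul (mono p) (W nu)) = (\1_(cg_basic p.1 p.2) g : K) *: cone.
Proof.
case: p => [a b]; rewrite /deg /= => gr gs gd dab amu.
have bnu : (size b <= size nu)%N by lia.
have -> : cmul (star (W mu)) (cmul (mono (a, b)) (W nu)) =
  cmul (star (cmul (star (W a)) (W mu))) (cmul (star (W b)) (W nu)).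
  by rewrite /mono starM starK !cmulA.
rewrite indicE; case: (asboolP (cg_basic a b g)) => [gab|ngab].
  case: (gab) => z [zr zd zs].
  rewrite mem_set // scale1r.
  have [d muE zE] : exists2 d, mu = a ++ d & z = concat d y.
    by apply: concat_prefix => //; rewrite -zr.
  have [d' nuE zE'] : exists2 d', nu = b ++ d' & z = concat d' y.
    by apply: concat_prefix => //; rewrite -zs.
  (* Both words of the monomial are continued by the same word [d]. *)
  have sd : size d = size d' by move: dab; rewrite muE nuE !size_cat; lia.
  have dd : d = d' by apply: (concat_inj sd (x := y)); rewrite -zE.
  rewrite muE nuE -dd !word_cat !cmulA word_iso cmul1a.
  by rewrite -!cmulA [X in cmul _ X]cmulA word_iso cmul1a word_iso.
rewrite memNset // scale0r.
case: (word_prefix amu) => [[d muE ->]|->]; last by rewrite star0 cmul0l.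
case: (word_prefix bnu) => [[d' nuE ->]|->]; last by rewrite cmul0r.
have sd : size d = size d' by move: dab; rewrite muE nuE !size_cat; lia.
apply: word_orth => //.
(* If the remaining words agreed, [g] would lie in the bisection. *)
apply/eqP => dd; apply: ngab; exists (concat d y); split.
- by rewrite gr muE concat_cat.
- by rewrite gd dab.
- by rewrite gs nuE concat_cat -dd.
Qed.

(** Cuntz's canonical endomorphism; its powers commute past words of the
    corresponding length. *)
Definition theta (x : A) : A := \sum_(i < n) cmul (S i) (cmul x (star (S i))).

Lemma theta1 : theta cone = cone.
Proof. by rewrite -[RHS]Ssum; apply: eq_bigr => i _; rewrite cmul1a. Qed.

Lemma theta_word1 x i : cmul (theta x) (S i) = cmul (S i) x.
Proof.
rewrite /theta cmul_suml (bigD1 i) //= big1 ?addr0.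
  by rewrite -!cmulA Siso cmula1.
by move=> j ji; rewrite -!cmulA Sorth // !cmul0r.
Qed.

Lemma star_theta x : star (theta x) = theta (star x).
Proof.
by rewrite /theta star_sum; apply: eq_bigr => i _; rewrite !starM starK cmulA.
Qed.

Lemma thetaM x y : cmul (theta x) (theta y) = theta (cmul x y).
Proof.
rewrite [theta y]/theta cmul_sumr; apply: eq_bigr => i _.
by rewrite cmulA theta_word1 !cmulA.
Qed.

Lemma iter_theta_word p x a : size a = p ->
  cmul (iter p theta x) (W a) = cmul (W a) x.
Proof.
elim: a p => [|i a IH] [|p] //= => [_|[pa]].
  by rewrite word_nil cmul1a cmula1.
by rewrite word_cons cmulA theta_word1 -cmulA IH // cmulA.
Qed.

Lemma iter_theta_iso p x : cmul (star x) x = cone ->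
  cmul (star (iter p theta x)) (iter p theta x) = cone.
Proof.
move=> x1; elim: p => // p IH; rewrite iterS star_theta thetaM IH.
exact: theta1.
Qed.

Fixpoint words (p : nat) : seq (seq 'I_n) :=
  if p is p'.+1 then [seq i :: w | i <- enum 'I_n, w <- words p'] else [:: [::]].

Lemma size_words p w : w \in words p -> size w = p.
Proof.
elim: p w => [|p IH] w /=; first by rewrite inE => /eqP ->.
by case/allpairsP => -[i v] /= [_ /IH <- ->].
Qed.

Lemma sum_words p : \sum_(w <- words p) cmul (W w) (star (W w)) = cone.
Proof.
elim: p => [|p IH] /=; first by rewrite big_seq1 word_nil star1 cmul1a.
rewrite big_allpairs_dep -[RHS]Ssum big_enum /=; apply: eq_bigr => i _.
transitivity (cmul (S i) (cmul (\sum_(w <- words p) cmul (W w) (star (W w))) (star (S i)))).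
  rewrite cmul_suml cmul_sumr; apply: eq_bigr => w _.
  by rewrite word_cons starM !cmulA.
by rewrite IH cmul1a.
Qed.

(** Words of length [p] and [q] give a rectangular system of matrix units, so an
    element is determined, and its norm is bounded, by its entries. *)
Lemma matrix_units p q (x : A) :
  x = \sum_(a <- words p) \sum_(b <- words q)
    cmul (W a) (cmul (cmul (star (W a)) (cmul x (W b))) (star (W b))).
Proof.
rewrite -[LHS]cmul1a -[LHS]cmula1 -{1}(sum_words p) -(sum_words q).
rewrite !cmul_suml; apply: eq_bigr => a _; rewrite cmul_sumr.
by apply: eq_bigr => b _; rewrite !cmulA.
Qed.

Lemma matrix_units_eq p q (x y : A) :
  (forall a b, size a = p -> size b = q ->
    cmul (star (W a)) (cmul x (W b)) = cmul (star (W a)) (cmul y (W b))) ->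
  x = y.
Proof.
move=> H; rewrite (matrix_units p q x) (matrix_units p q y).
apply: eq_big_seq => a /size_words sa; apply: eq_big_seq => b /size_words sb.
by rewrite H.
Qed.

Lemma matrix_units_norm p q (x : A) e :
  (forall a b, size a = p -> size b = q ->
    `|cmul (star (W a)) (cmul x (W b))| <= e) ->
  `|x| <= e *+ (size (words p) * size (words q)).
Proof.
move=> H; rewrite {1}(matrix_units p q x).
rewrite mulnC mulrnA; apply: (le_trans (ler_norm_sum _ _ _)).
rewrite -iter_addr_0 -(count_predT (words p)) -big_const_seq big_seq_cond.
rewrite [leRHS]big_seq_cond; apply: ler_sum => a; rewrite andbT => /size_words sa.
apply: (le_trans (ler_norm_sum _ _ _)).
rewrite -iter_addr_0 -(count_predT (words q)) -big_const_seq big_seq_cond.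
rewrite [leRHS]big_seq_cond; apply: ler_sum => b; rewrite andbT => /size_words sb.
apply: (le_trans (norm_mul_le1l _ (word_norm _))).
by apply: (le_trans (norm_mul_le1r _ (word_star_norm _))); exact: H.
Qed.

(** The isometries obtained from [W w] by powers of [theta] append [w] to all
    words of length [p] and [q] at once; hence this map is contractive, and its
    entry at [a], [b] is the entry of [x] at [a ++ w], [b ++ w]. *)
Definition compress p q w (x : A) : A :=
  cmul (star (iter p theta (W w))) (cmul x (iter q theta (W w))).

Lemma compress_norm p q w x : `|compress p q w x| <= `|x|.
Proof.
apply: le_trans (norm_mul_le1l _ _) (norm_mul_le1r _ _).
  by rewrite norm_star; apply/isometry_norm_le1/iter_theta_iso/word_iso.
by apply/isometry_norm_le1/iter_theta_iso/word_iso.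
Qed.

Lemma compressB p q w x y :
  compress p q w (x - y) = compress p q w x - compress p q w y.
Proof. by rewrite /compress cmulBl cmulBr. Qed.

Lemma compress_entry p q w x a b : size a = p -> size b = q ->
  cmul (star (W a)) (cmul (compress p q w x) (W b)) =
  cmul (star (W (a ++ w))) (cmul x (W (b ++ w))).
Proof.
move=> sa sb; rewrite /compress -!cmulA (iter_theta_word _ sb) !word_cat.
by rewrite !cmulA -starM iter_theta_word.
Qed.

End CuntzWords.

(** * Limits, and sums over roots of unity *)
Lemma complex_archi (R : realType) (e : R[i]) : 0 < e ->
  exists N : nat, N.+1%:R^-1 < e.
Proof.
move=> e0; have eE : (real_complex R (complex.Re e)) = e by apply: RRe_real; exact: gtr0_real.
have r0 : 0 < complex.Re e by move: e0; rewrite -eE ltcR.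
exists (Num.bound (complex.Re e)^-1).
rewrite -eE -(rmorph_nat (real_complex R)) -fmorphV ltcR.
rewrite -[ltRHS]invrK ltf_pV2 ?posrE ?invr_gt0 ?ltr0n //.
have := archi_boundP (ltW (_ : 0 < (complex.Re e)^-1)); rewrite invr_gt0 => /(_ r0) /lt_trans; apply.
by rewrite ltr_nat.
Qed.

Lemma half_gt0 (K : numFieldType) (e : K) : 0 < e -> 0 < e / 2.
Proof. by move=> e0; rewrite divr_gt0 // ltr0n. Qed.

Lemma closure_normP (K : numFieldType) (V : normedModType K) (B : set V) (a : V) :
  closure B a <-> forall e : K, 0 < e -> exists2 b, B b & `|a - b| < e.
Proof.
split=> [cB e e0|H C].
  have [b [Bb ab]] := cB _ (nbhsx_ballx a _ e0).
  by exists b => //; move: ab; rewrite -ball_normE.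
move=> /nbhs_ballP [e /= e0 eC]; have [b Bb ab] := H e e0.
by exists b; split => //; apply: eC; rewrite -ball_normE.
Qed.

Lemma closed_normP (K : numFieldType) (V : normedModType K) (B : set V) :
  closed B <-> forall a, (forall e : K, 0 < e -> exists2 b, B b & `|a - b| < e) -> B a.
Proof.
by split=> H a; [move=> /closure_normP /H|move=> /closure_normP; apply: H].
Qed.

Lemma eq_of_norm_sub_le (K : numFieldType) (V : normedModType K) (a b : V) :
  (forall e : K, 0 < e -> `|a - b| <= e) -> a = b.
Proof.
move=> H; apply/eqP; rewrite -subr_eq0 -normr_le0; apply/ler_addgt0Pr => e e0.
by rewrite add0r H.
Qed.

(** Extension by continuity: if [u x] depends on [f x] without increasing
    distances and [a] is a limit of values of [f], then [u] has a limit along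
    them, with an explicit error. *)
Lemma nonexpansive_limit (K : numFieldType) (X : Type) (B : normedModType K)
    (V : completeNormedModType K) (f : X -> B) (u : X -> V) (a : B) :
  (forall e : K, 0 < e -> exists x, `|a - f x| < e) ->
  (forall x y, `|u x - u y| <= `|f x - f y|) ->
  exists L, forall x, `|L - u x| <= `|a - f x|.
Proof.
move=> fa uf.
(* The image under [u] of the trace of the neighbourhoods of [a]. *)
pose F : set_system V := [set P | exists2 U, nbhs a U & forall x, U (f x) -> P (u x)].
have FF : ProperFilter F.
  apply: Build_ProperFilter_ex.
    move=> P [U /nbhs_ballP[e /= e0 eU] UP]; have [x ax] := fa e e0.
    by exists (u x); apply/UP/eU; rewrite -ball_normE.
  split.
  - by exists setT => //; exact: filterT.
  - move=> P Q [U aU UP] [U' aU' UQ]; exists (U `&` U'); first exact: filterI.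
    by move=> x [/UP Px /UQ].
  - by move=> P Q PQ [U aU UP]; exists U => // x /UP /PQ.
have Fnear (e : K) x : 0 < e -> F (ball (u x) (`|a - f x| + e)).
  move=> e0; exists (ball a e); first exact: nbhsx_ballx.
  rewrite -!ball_normE /= => y ay; apply: (le_lt_trans (uf _ _)).
  rewrite (le_lt_trans (ler_distD a _ _)) // distrC ltrD2l.
  by [].
have /cvg_ex [L FL] : cvg F.
  apply: cauchy_cvg; apply: cauchy_exP => e e0.
  have [x ax] := fa _ (half_gt0 e0); exists (u x).
  apply: filterS (Fnear _ x (half_gt0 e0)) => y; rewrite -!ball_normE /=.
  by move=> /lt_trans; apply; rewrite [ltRHS](splitr e) ltrD2r.
exists L => x; apply/ler_addgt0Pr => e e0.
have FI : F (ball L (e / 2) `&` ball (u x) (`|a - f x| + e / 2)).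
  by apply: filterI; [exact/FL/nbhsx_ballx/half_gt0|exact/Fnear/half_gt0].
have [y []] := filter_ex FI; rewrite -!ball_normE /= => Ly uxy.
rewrite (le_trans (ler_distD y _ _)) // [X in _ <= _ + X](splitr e) addrA [leRHS]addrC.
by rewrite lerD ?(ltW Ly) // distrC (ltW uxy).
Qed.

Lemma prim_root_exists (K : numClosedFieldType) k : (0 < k)%N ->
  exists z : K, k.-primitive_root z.
Proof.
pose p : {poly K} := 'X^k - 1; have [r Dp] := closed_field_poly_normal p.
move=> k_gt0; rewrite (monicP _) ?monicXnsubC // scale1r in Dp.
have rn1 : all k.-unity_root r by apply/allP=> z; rewrite -root_prod_XsubC -Dp.
have sz_r : (k < (size r).+1)%N by rewrite -(size_prod_XsubC r id) -Dp size_XnsubC.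
have [|z] := hasP (cyclic.has_prim_root k_gt0 rn1 _ sz_r); last by exists z.
by rewrite -separable_prod_XsubC -Dp separable_Xn_sub_1 // pnatr_eq0 -lt0n.
Qed.

Lemma prim_root_norm (K : numClosedFieldType) k (z : K) : k.-primitive_root z ->
  `|z| = 1.
Proof.
move=> zk; apply/eqP; rewrite -(@pexpr_eq1 _ _ k) ?(prim_order_gt0 zk) //.
by rewrite -normrX (prim_expr_order zk) normr1.
Qed.

Lemma sum_prim_root (K : numClosedFieldType) k (z : K) (d : int) :
  k.-primitive_root z -> (`|d|%N < k)%N ->
  \sum_(i < k) (z ^+ i) ^ d = k%:R * (d == 0)%:R.
Proof.
move=> zk dk; have z0 : z != 0.
  by rewrite -normr_gt0 (prim_root_norm zk) ltr01.
have -> : \sum_(i < k) (z ^+ i) ^ d = \sum_(i < k) (z ^ d) ^+ i.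
  by apply: eq_bigr => i _; rewrite !exprnP !exprz_exp mulrC.
have [->|d0] := eqVneq d 0.
  under eq_bigr do rewrite expr0z expr1n.
  by rewrite sumr_const card_ord mulr1.
have zd1 : z ^ d != 1.
  have zn m : (0 < m < k)%N -> z ^+ m != 1.
    move=> /andP[m0 mk]; rewrite -(prim_order_dvd zk); apply/negP => /dvdn_leq.
    by rewrite m0 leqNgt mk => /(_ isT).
  case: d d0 dk => [m|m] d0 mk; first by apply: zn; rewrite lt0n d0.
  by rewrite [z ^ _]/((z ^+ m.+1)^-1) invr_eq1; apply: zn; rewrite mk.
have : (z ^ d - 1) * \sum_(i < k) (z ^ d) ^+ i = 0.
  rewrite -subrX1 exprnP exprz_exp mulrC -exprz_exp -exprnP.
  by rewrite (prim_expr_order zk) exp1rz subrr.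
by move/eqP; rewrite mulf_eq0 subr_eq0 (negbTE zd1) /= mulr0 => /eqP.
Qed.

Lemma norm_exprz (K : numClosedFieldType) (z : K) (d : int) : `|z| = 1 ->
  `|z ^ d| = 1.
Proof.
move=> z1; case: d => m; first by rewrite -exprnP normrX z1 expr1n.
by rewrite [z ^ _]/((z ^+ m.+1)^-1) normfV normrX z1 expr1n invr1.
Qed.

Lemma conj_exprz (K : numClosedFieldType) (z : K) (d : int) : `|z| = 1 ->
  Num.conj (z ^ d) = z ^ (- d).
Proof.
move=> z1; have z0 : z != 0 by rewrite -normr_gt0 z1 ltr01.
apply: (mulfI (x := z ^ d)); first by rewrite expfz_neq0.
by rewrite -normCK norm_exprz // expr1n -expfzDr // subrr expr0z.
Qed.

Lemma seq_bound (T : eqType) (h : T -> nat) (l : seq T) :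
  exists M, forall p, p \in l -> (h p <= M)%N.
Proof.
elim: l => [|q l [M HM]]; first by exists 0%N.
exists (maxn (h q) M) => p; rewrite inE => /orP[/eqP ->|/HM pM].
  exact: leq_maxl.
by rewrite leq_max pM orbT.
Qed.

(** * Fourier analysis of an isometric circle action *)

(** A list of coefficients and indices stands for a finite combination of
    generators.  Working with lists, a Fourier multiplier is defined without
    knowing that generators are linearly independent; the norm estimates below
    then show that it depends on the represented element only. *)
Section FormalCombinations.
Context {K : numClosedFieldType} {I : eqType}.
Variable deg : I -> int.
Implicit Types l : seq (K * I).

Definition ev {V : lmodType K} (m : I -> V) l : V := \sum_(p <- l) p.1 *: m p.2.

Definition multiplier (w : int -> K) l := [seq (w (deg p.2) * p.1, p.2) | p <- l].

Definition lscale (c : K) l := [seq (c * p.1, p.2) | p <- l].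

Definition delta (k d : int) : K := (d == k)%:R.

Lemma ev_cat (V : lmodType K) (m : I -> V) l l' : ev m (l ++ l') = ev m l + ev m l'.
Proof. by rewrite /ev big_cat. Qed.

Lemma ev_lscale (V : lmodType K) (m : I -> V) c l : ev m (lscale c l) = c *: ev m l.
Proof.
by rewrite /ev big_map scaler_sumr; apply: eq_bigr => p _; rewrite scalerA.
Qed.

Lemma ev_multiplier (V : lmodType K) (m : I -> V) w l :
  ev m (multiplier w l) = \sum_(p <- l) w (deg p.2) *: (p.1 *: m p.2).
Proof. by rewrite /ev big_map; apply: eq_bigr => p _; rewrite scalerA. Qed.

Lemma multiplier_cat w l l' : multiplier w (l ++ l') = multiplier w l ++ multiplier w l'.
Proof. by rewrite /multiplier map_cat. Qed.

Lemma multiplier_lscale w c l : multiplier w (lscale c l) = lscale c (multiplier w l).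
Proof. by rewrite /multiplier /lscale -!map_comp; apply: eq_map => p /=; rewrite mulrCA. Qed.

Lemma ev_multiplierB (V : lmodType K) (m : I -> V) w l l' :
  ev m (multiplier w l) - ev m (multiplier w l') = ev m (multiplier w (l ++ lscale (-1) l')).
Proof. by rewrite multiplier_cat multiplier_lscale ev_cat ev_lscale scaleN1r. Qed.

Lemma evB (V : lmodType K) (m : I -> V) l l' :
  ev m l - ev m l' = ev m (l ++ lscale (-1) l').
Proof. by rewrite ev_cat ev_lscale scaleN1r. Qed.

Lemma eq_multiplier w w' l : (forall p, p \in l -> w (deg p.2) = w' (deg p.2)) ->
  multiplier w l = multiplier w' l.
Proof. by move=> H; apply/eq_in_map => p /H ->. Qed.

End FormalCombinations.
Arguments delta {K}.

Section Fourier.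
Context {K : numClosedFieldType} {A : cstarAlgType K} {I : eqType}.
Variables (deg : I -> int) (m : I -> A).
Implicit Types (l : seq (K * I)) (a b : A).

Hypothesis dense : forall (a : A) (e : K), 0 < e -> exists l, `|a - ev m l| < e.
Hypothesis gauge : forall (z : K) l, `|z| = 1 ->
  `|ev m (multiplier deg (fun d => z ^ d) l)| <= `|ev m l|.

(** A multiplier whose symbol is a combination of characters is the same
    combination of gauge automorphisms, so it is bounded by the total mass. *)
Lemma multiplier_kernel J (r : seq J) (t z : J -> K) w l :
  (forall i, `|z i| = 1) ->
  (forall p, p \in l -> w (deg p.2) = \sum_(i <- r) t i * z i ^ deg p.2) ->
  `|ev m (multiplier deg w l)| <= (\sum_(i <- r) `|t i|) * `|ev m l|.
Proof.
move=> z1 wE; rewrite (eq_multiplier (w' := fun d => \sum_(i <- r) t i * z i ^ d) wE).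
have -> : ev m (multiplier deg (fun d => \sum_(i <- r) t i * z i ^ d) l) =
    \sum_(i <- r) t i *: ev m (multiplier deg (fun d => z i ^ d) l).
  rewrite ev_multiplier.
  under eq_bigr => p _ do rewrite scaler_suml.
  rewrite exchange_big /=; apply: eq_bigr => i _.
  by rewrite ev_multiplier scaler_sumr; apply: eq_bigr => p _; rewrite [RHS]scalerA.
rewrite mulr_suml; apply: (le_trans (ler_norm_sum _ _ _)); apply: ler_sum => i _.
by rewrite normrZ ler_wpM2l // gauge.
Qed.

(** Averaging over enough roots of unity to separate the finitely many degrees
    that occur. *)
Lemma delta_contract k l : `|ev m (multiplier deg (delta k) l)| <= `|ev m l|.
Proof.
have [M HM] := seq_bound (fun p => `|deg p.2|%N) l; pose N := (M + `|k|).+1.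
have [z zN] := prim_root_exists K (ltn0Sn (M + `|k|)).
have z1 (i : 'I_N) : `|z ^+ i| = 1 by rewrite normrX (prim_root_norm zN) expr1n.
have N0 : (N%:R : K) != 0 by rewrite pnatr_eq0.
apply: (le_trans (@multiplier_kernel _ (index_enum 'I_N)
  (fun i => N%:R^-1 * (z ^+ i) ^ (- k)) (fun i => z ^+ i) _ _ _ _)) => //.
  move=> p /HM pM; transitivity (N%:R^-1 * \sum_(i < N) (z ^+ i) ^ (deg p.2 - k)).
    rewrite (sum_prim_root zN); last by rewrite /N; lia.
    by rewrite mulrA mulVf // mul1r subr_eq0.
  rewrite mulr_sumr; apply: eq_bigr => i _; rewrite -mulrA -expfzDr 1?addrC //.
  by rewrite -normr_gt0 z1 ltr01.
rewrite (eq_bigr (fun=> N%:R^-1)); last first.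
  by move=> i _; rewrite normrM normfV normr_nat norm_exprz // mulr1.
by rewrite sumr_const card_ord -[_ *+ _]mulr_natr mulVf // mul1r.
Qed.

(** The continuous extension to the whole algebra of the projection of
    combinations onto their part of degree [k]. *)
Definition fourier (k : int) a : A :=
  get [set L | forall l, `|L - ev m (multiplier deg (delta k) l)| <= `|a - ev m l|].

Lemma fourierP k a l : `|fourier k a - ev m (multiplier deg (delta k) l)| <= `|a - ev m l|.
Proof.
have [|L HL] := @nonexpansive_limit K _ A A (ev m)
  (fun l => ev m (multiplier deg (delta k) l)) a (@dense a).
  by move=> x y; rewrite ev_multiplierB evB delta_contract.
have : exists L, [set L | forall l, `|L - ev m (multiplier deg (delta k) l)| <= `|a - ev m l|] L.
  by exists L.
by move/getPex; apply.
Qed.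

Lemma fourier_ev k l : fourier k (ev m l) = ev m (multiplier deg (delta k) l).
Proof.
by apply: eq_of_norm_sub_le => e e0; rewrite (le_trans (fourierP _ _ l)) // subrr normr0 ltW.
Qed.

Lemma fourier_nonexpansive k a b : `|fourier k a - fourier k b| <= `|a - b|.
Proof.
apply/ler_addgt0Pr => e e0; have e4 := half_gt0 (half_gt0 e0).
have [l al] := dense a e4; have [l' bl] := dense b e4.
have H := ltW al; have H' := ltW bl.
rewrite (le_trans (ler_distD (ev m (multiplier deg (delta k) l)) _ _)) //.
rewrite (le_trans (lerD (fourierP _ _ _) (ler_distD (ev m (multiplier deg (delta k) l')) _ _))) //.
have D : `|ev m (multiplier deg (delta k) l) - ev m (multiplier deg (delta k) l')| <=
    e / 2 / 2 + `|a - b| + e / 2 / 2.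
  rewrite ev_multiplierB (le_trans (delta_contract _ _)) // -evB.
  rewrite (le_trans (ler_distD b _ _)) // lerD //.
  by rewrite (le_trans (ler_distD a _ _)) // lerD // distrC.
have D' : `|ev m (multiplier deg (delta k) l') - fourier k b| <= e / 2 / 2.
  by rewrite distrC (le_trans (fourierP _ _ _)).
rewrite (le_trans (lerD H (lerD D D'))) //.
by rewrite le_eqVlt; apply/orP; left; apply/eqP; field.
Qed.

(** Identities between Lipschitz maps need only be checked on the dense set
    of finite combinations. *)
Definition lipschitz_map (F : A -> A) :=
  exists2 M : K, 0 <= M & forall a b, `|F a - F b| <= M * `|a - b|.

Lemma lip_fourier k : lipschitz_map (fourier k).
Proof. by exists 1 => // a b; rewrite mul1r fourier_nonexpansive. Qed.

Lemma lip_id : lipschitz_map id.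
Proof. by exists 1 => // a b; rewrite mul1r. Qed.

Lemma lip_cst c : lipschitz_map (fun=> c).
Proof. by exists 0 => // a b; rewrite subrr normr0 mul0r. Qed.

Lemma lip_star F : lipschitz_map F -> lipschitz_map (fun a => star (F a)).
Proof. by case=> M M0 H; exists M => // a b; rewrite -starB norm_star. Qed.

Lemma lip_mull c F : lipschitz_map F -> lipschitz_map (fun a => cmul c (F a)).
Proof.
case=> M M0 H; exists (`|c| * M) => [|a b]; first by rewrite mulr_ge0.
by rewrite -cmulBr (le_trans (ler_norm_cmul _ _)) // -mulrA ler_wpM2l.
Qed.

Lemma lip_mulr c F : lipschitz_map F -> lipschitz_map (fun a => cmul (F a) c).
Proof.
case=> M M0 H; exists (`|c| * M) => [|a b]; first by rewrite mulr_ge0.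
by rewrite -cmulBl (le_trans (ler_norm_cmul _ _)) // mulrC -mulrA ler_wpM2l.
Qed.

Lemma lip_comp F G : lipschitz_map F -> lipschitz_map G ->
  lipschitz_map (fun a => F (G a)).
Proof.
case=> M M0 HF [N N0 HG]; exists (M * N) => [|a b]; first by rewrite mulr_ge0.
by rewrite (le_trans (HF _ _)) // -mulrA ler_wpM2l.
Qed.

Lemma lip_add F G : lipschitz_map F -> lipschitz_map G ->
  lipschitz_map (fun a => F a + G a).
Proof.
case=> M M0 HF [N N0 HG]; exists (M + N) => [|a b]; first by rewrite addr_ge0.
by rewrite opprD addrACA (le_trans (ler_normD _ _)) // mulrDl lerD.
Qed.

Lemma lip_scale c F : lipschitz_map F -> lipschitz_map (fun a => c *: F a).
Proof.
case=> M M0 HF; exists (`|c| * M) => [|a b]; first by rewrite mulr_ge0.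
by rewrite -scalerBr normrZ -mulrA ler_wpM2l.
Qed.

Lemma lip_sum J (r : seq J) (F : J -> A -> A) : (forall j, lipschitz_map (F j)) ->
  lipschitz_map (fun a => \sum_(j <- r) F j a).
Proof.
move=> HF; elim: r => [|j r IH].
  by under [X in lipschitz_map X]eq_fun do rewrite big_nil; exact: lip_cst.
by under [X in lipschitz_map X]eq_fun do rewrite big_cons; exact: lip_add.
Qed.

Lemma lip_eq F G : lipschitz_map F -> lipschitz_map G ->
  (forall l, F (ev m l) = G (ev m l)) -> F =1 G.
Proof.
case=> M M0 HF [N N0 HG] FG a; apply: eq_of_norm_sub_le => e e0.
have MN : 0 < M + N + 1 by rewrite ltr_wpDl // addr_ge0.
have [|l /ltW al] := @dense a (e / (M + N + 1)); first by rewrite divr_gt0.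
rewrite (le_trans (ler_distD (F (ev m l)) _ _)) // [in X in _ + X]FG.
rewrite (le_trans (lerD (HF _ _) (HG _ _))) // [`|ev m l - a|]distrC -mulrDl.
rewrite (le_trans (ler_wpM2l (addr_ge0 M0 N0) al)) // mulrCA ler_piMr ?(ltW e0) //.
by rewrite ler_pdivrMr // mul1r lerDl.
Qed.

Lemma lip_nonexpansive F : lipschitz_map F ->
  (forall l l', `|F (ev m l) - F (ev m l')| <= `|ev m l - ev m l'|) ->
  forall a b, `|F a - F b| <= `|a - b|.
Proof.
case=> M M0 HF H a b; apply/ler_addgt0Pr => e e0.
have M1 : 0 < M + 1 by rewrite ltr_wpDl.
have d0 : 0 < e / 2 / (M + 1) by rewrite divr_gt0 // half_gt0.
have [l /ltW al] := @dense a _ d0; have [l' /ltW bl] := @dense b _ d0.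
have {}HF c l0 : `|c - ev m l0| <= e / 2 / (M + 1) ->
    `|F c - F (ev m l0)| <= M * (e / 2 / (M + 1)).
  by move=> cl; rewrite (le_trans (HF _ _)) // ler_wpM2l.
rewrite (le_trans (ler_distD (F (ev m l)) _ _)) //.
rewrite (le_trans (lerD (HF _ _ al) (ler_distD (F (ev m l')) _ _))) //.
have D : `|F (ev m l) - F (ev m l')| <=
    e / 2 / (M + 1) + `|a - b| + e / 2 / (M + 1).
  rewrite (le_trans (H _ _)) //.
  rewrite (le_trans (ler_distD b _ _)) // lerD //.
  by rewrite (le_trans (ler_distD a _ _)) // lerD // distrC.
have D' : `|F (ev m l') - F b| <= M * (e / 2 / (M + 1)).
  by rewrite distrC HF.
rewrite (le_trans (lerD (lexx _) (lerD D D'))) //.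
rewrite le_eqVlt; apply/orP; left; apply/eqP; field.
by rewrite gt_eqF.
Qed.

Lemma fourier_linear k (c : K) a b :
  fourier k (c *: a + b) = c *: fourier k a + fourier k b.
Proof.
have E l : forall b, fourier k (c *: ev m l + b) = c *: fourier k (ev m l) + fourier k b.
  apply: lip_eq => [||l'].
  - by apply: lip_comp; [exact: lip_fourier|apply: lip_add; [exact: lip_cst|exact: lip_id]].
  - by apply: lip_add; [exact: lip_cst|exact: lip_fourier].
  - rewrite -ev_lscale -ev_cat !fourier_ev multiplier_cat multiplier_lscale.
    by rewrite ev_cat ev_lscale.
move: a; apply: lip_eq => //.
- by apply: lip_comp; [exact: lip_fourier|apply: lip_add; [exact/lip_scale/lip_id|exact: lip_cst]].
- by apply: lip_add; [exact/lip_scale/lip_fourier|exact: lip_cst].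
Qed.

Lemma fourierD k a b : fourier k (a + b) = fourier k a + fourier k b.
Proof. by have := fourier_linear k 1 a b; rewrite !scale1r. Qed.

Lemma fourier0 k : fourier k 0 = 0.
Proof. by apply: (addrI (fourier k 0)); rewrite -fourierD !addr0. Qed.

Lemma fourierZ k c a : fourier k (c *: a) = c *: fourier k a.
Proof. by rewrite -[c *: a]addr0 fourier_linear fourier0 addr0. Qed.

Lemma fourier_sum k J (r : seq J) (F : J -> A) :
  fourier k (\sum_(j <- r) F j) = \sum_(j <- r) fourier k (F j).
Proof. exact: (big_morph (fourier k) (fourierD k) (fourier0 k)). Qed.

Lemma fourier_generator k i : fourier k (m i) = delta k (deg i) *: m i.
Proof.
have -> : m i = ev m [:: (1, i)] by rewrite /ev big_seq1 scale1r.
by rewrite fourier_ev ev_multiplier /ev !big_seq1.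
Qed.

Lemma fourier_evE k l : fourier k (ev m l) = \sum_(p <- l) delta k (deg p.2) *: (p.1 *: m p.2).
Proof. by rewrite fourier_ev ev_multiplier. Qed.

Lemma fourier_fourier k j a :
  fourier k (fourier j a) = if k == j then fourier j a else 0.
Proof.
move: a; apply: lip_eq => [||l].
- by apply: lip_comp; exact: lip_fourier.
- by case: eqP => _; [exact: lip_fourier|exact: lip_cst].
rewrite [fourier j _]fourier_evE fourier_sum.
have E p : fourier k (delta j (deg p.2) *: (p.1 *: m p.2)) =
    if k == j then delta j (deg p.2) *: (p.1 *: m p.2) else 0.
  rewrite !fourierZ fourier_generator /delta.
  case: (eqVneq (deg p.2) j) => [->|_].
    by rewrite eq_sym; case: eqP => _; rewrite ?scale1r ?scale0r ?scaler0.
  by rewrite !scale0r; case: eqP.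
under eq_bigr do rewrite E.
by case: eqP => _ //; rewrite big1.
Qed.

Hypothesis mul_generator : forall i j, cmul (m i) (m j) = 0 \/
  exists2 r, cmul (m i) (m j) = m r & deg r = deg i + deg j.

(** The range of [fourier j] consists of elements of degree [j], so multiplication
    by one shifts degrees by [j]. *)
Lemma fourier_mul k j a b :
  fourier k (cmul a (fourier j b)) = cmul (fourier (k - j) a) (fourier j b).
Proof.
have M i i' : fourier k (cmul (m i) (m i')) = delta k (deg i + deg i') *: cmul (m i) (m i').
  case: (mul_generator i i') => [->|[r -> <-]]; first by rewrite fourier0 scaler0.
  exact: fourier_generator.
have Mi i : forall b,
    fourier k (cmul (m i) (fourier j b)) = cmul (fourier (k - j) (m i)) (fourier j b).
  apply: lip_eq => [||l].
  - by apply/lip_comp/lip_mull/lip_fourier; exact: lip_fourier.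
  - exact/lip_mull/lip_fourier.
  rewrite fourier_evE !cmul_sumr fourier_sum; apply: eq_bigr => p _.
  rewrite !cmulZr !fourierZ M fourier_generator cmulZl /delta.
  case: eqVneq => [->|_]; last by rewrite !scale0r.
  have -> : (deg i + j == k) = (deg i == k - j) by lia.
  by rewrite !scalerA mulrC.
move: a; apply: lip_eq => [||l].
- by apply/lip_comp/lip_mulr/lip_id; exact: lip_fourier.
- exact/lip_mulr/lip_fourier.
rewrite /ev cmul_suml !fourier_sum cmul_suml; apply: eq_bigr => p _.
by rewrite cmulZl !fourierZ Mi cmulZl.
Qed.

Hypothesis star_generator : forall i, exists2 j, star (m i) = m j & deg j = - deg i.

Lemma fourier_star k a : fourier k (star a) = star (fourier (- k) a).
Proof.
move: a; apply: lip_eq => [||l].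
- by apply/lip_comp/lip_star/lip_id; exact: lip_fourier.
- exact/lip_star/lip_fourier.
rewrite /ev star_sum !fourier_sum star_sum; apply: eq_bigr => p _.
rewrite starZ !fourierZ starZ fourier_generator starZ; congr (_ *: _).
have [j -> dj] := star_generator p.2.
rewrite fourier_generator /delta dj rmorph_nat.
by rewrite eqr_oppLR.
Qed.

(** The Fejer means: the double sum contains the coefficient of degree [d]
    [N - `|d|] times, or never if `|d| exceeds [N]. *)
Definition fejer N a : A :=
  N%:R^-1 *: \sum_(j < N) \sum_(j' < N) fourier (j%:Z - j'%:Z) a.

Definition fejer_weight N (d : int) : K :=
  N%:R^-1 * \sum_(j < N) \sum_(j' < N) (d == j%:Z - j'%:Z)%:R.

Lemma lip_fejer N : lipschitz_map (fejer N).
Proof. by apply/lip_scale/lip_sum => j; apply/lip_sum => j'; exact: lip_fourier. Qed.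

Lemma fejer_ev N l : fejer N (ev m l) = ev m (multiplier deg (fejer_weight N) l).
Proof.
rewrite ev_multiplier /fejer.
under eq_bigr => j _ do under eq_bigr => j' _ do rewrite fourier_evE.
under eq_bigr => j _ do rewrite exchange_big /=.
rewrite exchange_big /= scaler_sumr; apply: eq_bigr => p _.
rewrite /fejer_weight -scalerA scaler_suml; congr (_ *: _).
by apply: eq_bigr => j _; rewrite scaler_suml.
Qed.

(** The Fejer kernel is the nonnegative function |1 + z + .. + z^(N-1)|^2 / N of
    mass 1, hence the means are contractive. *)
Lemma fejer_contract N l : (0 < N)%N ->
  `|ev m (multiplier deg (fejer_weight N) l)| <= `|ev m l|.
Proof.
move=> N_gt0; have [M HM] := seq_bound (fun p => `|deg p.2|%N) l; pose Q := (M + N).+1.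
have [z zQ] := prim_root_exists K (ltn0Sn (M + N)).
have z1 (i : 'I_Q) : `|z ^+ i| = 1 by rewrite normrX (prim_root_norm zQ) expr1n.
have z0 (i : 'I_Q) : z ^+ i != 0 by rewrite -normr_gt0 z1 ltr01.
have Q0 : (Q%:R : K) != 0 by rewrite pnatr_eq0.
have N0 : (N%:R : K) != 0 by rewrite pnatr_eq0 -lt0n.
pose t (i : 'I_Q) : K := `|\sum_(j < N) (z ^+ i) ^ j| ^+ 2 / (Q%:R * N%:R).
have tE d : (`|d| <= M)%N -> fejer_weight N d = \sum_(i < Q) t i * (z ^+ i) ^ d.
  move=> dM.
  have tiE (i : 'I_Q) : t i * (z ^+ i) ^ d =
      (Q%:R * N%:R)^-1 * \sum_(j < N) \sum_(j' < N) (z ^+ i) ^ (d - (j%:Z - j'%:Z)).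
    rewrite /t normCK rmorph_sum /= mulrAC mulrC; congr (_ * _).
    rewrite mulrAC mulrC mulr_suml; apply: eq_bigr => j _.
    rewrite mulr_suml mulr_sumr; apply: eq_bigr => j' _.
    by rewrite conj_exprz // -!expfzDr //; congr (_ ^ _); lia.
  under eq_bigr => i _ do rewrite tiE.
  rewrite -mulr_sumr exchange_big /= /fejer_weight invfM [Q%:R^-1 * _]mulrC -mulrA.
  congr (_ * _); rewrite mulr_sumr; apply: eq_bigr => j _.
  rewrite exchange_big mulr_sumr; apply: eq_bigr => j' _ /=.
  rewrite (sum_prim_root zQ); last by rewrite /Q; have := ltn_ord j; have := ltn_ord j'; lia.
  by rewrite mulrA mulVf // mul1r subr_eq0.
rewrite -[leRHS]mul1r.
apply: (le_trans (@multiplier_kernel _ (index_enum 'I_Q) t (fun i => z ^+ i) _ _ z1 _)).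
  by move=> p /HM; exact: tE.
rewrite ler_wpM2r //.
have t_ge0 i : 0 <= t i by rewrite divr_ge0 ?exprn_ge0 // mulr_ge0.
have -> : \sum_i `|t i| = fejer_weight N 0.
  by rewrite tE //; apply: eq_bigr => i _; rewrite ger0_norm // expr0z mulr1.
rewrite /fejer_weight (eq_bigr (fun=> 1)).
  by rewrite sumr_const card_ord mulVf.
move=> j _; rewrite (bigD1 j) //= subrr eqxx big1 ?addr0 // => j' jj'.
by rewrite eq_sym subr_eq0 eqz_nat eq_sym (inj_eq val_inj) (negbTE jj').
Qed.

Lemma sum_ltn N k : (\sum_(j < N) (j + k < N) = N - k)%N.
Proof.
have E M : (\sum_(j < M) (j + k < N) = minn M (N - k))%N.
  elim: M => [|M IH]; first by rewrite big_ord0 min0n.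
  by rewrite big_ord_recr /= IH; lia.
by rewrite E; lia.
Qed.

Lemma fejer_count N (d : int) :
  (\sum_(j < N) \sum_(j' < N) (d == j%:Z - j'%:Z)%R = N - `|d|)%N.
Proof.
have E x : (\sum_(j < N) (x == j :> nat) = (x < N))%N.
  rewrite (eq_bigr (fun j : 'I_N => if j == x :> nat then 1 else 0)%N).
    by rewrite -big_mkcond (big_ord1_eq _ (fun=> 1%N)); case: ltnP.
  by move=> j _; rewrite eq_sym; case: eqP.
case: d => k.
  rewrite exchange_big /= -sum_ltn; apply: eq_bigr => j' _.
  by rewrite -E; apply: eq_bigr => j _; congr nat_of_bool; lia.
rewrite -sum_ltn; apply: eq_bigr => j _.
by rewrite -E; apply: eq_bigr => j' _; congr nat_of_bool; lia.
Qed.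

Lemma fejer_weightE N d : (0 < N)%N -> (`|d| <= N)%N ->
  fejer_weight N d = 1 - `|d|%N%:R / N%:R.
Proof.
move=> N0 dN; have N1 : (N%:R : K) != 0 by rewrite pnatr_eq0 -lt0n.
rewrite /fejer_weight; under eq_bigr do rewrite -natr_sum.
rewrite -natr_sum fejer_count natrB // mulrBr mulVf //.
by rewrite [X in _ - X]mulrC.
Qed.

Hypothesis archi : forall e : K, 0 < e -> exists N : nat, N.+1%:R^-1 < e.

(** On a combination of degrees at most [M] the error is at most [C / N], with
    [C] depending on the combination; contractivity carries this over to
    limits. *)
Lemma fejer_converges a e : 0 < e -> exists2 N, (0 < N)%N & `|a - fejer N a| < e.
Proof.
move=> e0; have e4 := half_gt0 (half_gt0 e0).
have [l al] := dense a e4; have [M HM] := seq_bound (fun p => `|deg p.2|%N) l.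
pose C : K := M%:R * \sum_(p <- l) `|p.1 *: m p.2|.
have C0 : 0 <= C by rewrite mulr_ge0 // sumr_ge0.
have [|N' HN'] := archi (e := e / 2 / 2 / (C + 1)).
  by rewrite divr_gt0 // ltr_wpDl.
pose N := (M + N').+1; exists N => //.
have D : `|ev m l - fejer N (ev m l)| <= e / 2 / 2.
  have -> : ev m l - fejer N (ev m l) =
      \sum_(p <- l) (`|deg p.2|%N%:R / N%:R) *: (p.1 *: m p.2).
    rewrite fejer_ev ev_multiplier /ev -sumrB; apply: eq_big_seq => p pl.
    rewrite -[X in X - _]scale1r -scalerBl fejer_weightE //; last first.
      by rewrite /N (leq_trans (HM _ pl)) // leqW // leq_addr.
    by rewrite opprB addrCA subrr addr0.
  rewrite (le_trans (ler_norm_sum _ _ _)) //.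
  apply: (@le_trans _ _ (C / N%:R)).
    rewrite /C mulrAC mulr_sumr big_seq [leRHS]big_seq; apply: ler_sum => p pl.
    rewrite [leLHS]normrZ ler_wpM2r // ger0_norm ?divr_ge0 // ler_wpM2r ?invr_ge0 //.
    by rewrite ler_nat HM.
  have C1 : 0 < C + 1 by rewrite ltr_wpDl.
  apply: (@le_trans _ _ ((C + 1) * N'.+1%:R^-1)).
    rewrite ler_pM ?invr_ge0 ?lerDl // lef_pV2 ?posrE ?ltr0n // ler_nat.
    by rewrite /N ltnS leq_addl.
  by rewrite mulrC -ler_pdivlMr // ltW.
rewrite (le_lt_trans (ler_distD (ev m l) _ _)) //.
rewrite (le_lt_trans (lerD (ltW al) (ler_distD (fejer N (ev m l)) _ _))) //.
have D' : `|fejer N (ev m l) - fejer N a| <= e / 2 / 2.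
  apply: le_trans (ltW al); rewrite [leRHS]distrC.
  apply: lip_nonexpansive; first exact: lip_fejer.
  by move=> l1 l2; rewrite !fejer_ev ev_multiplierB evB fejer_contract.
rewrite (le_lt_trans (lerD (lexx _) (lerD D D'))) //.
rewrite [ltRHS](_ : e = e / 2 / 2 + (e / 2 / 2 + e / 2 / 2) + e / 2 / 2); last by field.
by rewrite ltrDl.
Qed.

(** Each Fejer mean of such an element is its zeroth coefficient. *)
Lemma fourier_only_zero a : (forall k, k != 0 -> fourier k a = 0) -> fourier 0 a = a.
Proof.
move=> a0; symmetry; apply: eq_of_norm_sub_le => e /(fejer_converges a)[N N0 /ltW aN].
suff <- : fejer N a = fourier 0 a by [].
rewrite /fejer (eq_bigr (fun=> fourier 0 a)).
  by rewrite sumr_const card_ord -[fourier 0 a *+ N]scaler_nat scalerA mulVf ?scale1r // pnatr_eq0 -lt0n.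
move=> j _; rewrite (bigD1 j) //= subrr big1 ?addr0 // => j' jj'.
by apply: a0; rewrite subr_eq0 eqz_nat eq_sym.
Qed.

(** Replace [b] by its Fejer means.  In degree [k <= 0] a product of coefficients
    of nonnegative degrees survives only if both degrees are zero. *)
Lemma fourier_mul_analytic a b k : (forall j, j < 0 -> fourier j a = 0) ->
  (forall j, j < 0 -> fourier j b = 0) -> k <= 0 ->
  fourier k (cmul a b) = if k == 0 then cmul (fourier 0 a) (fourier 0 b) else 0.
Proof.
move=> a0 b0 k0; apply: eq_of_norm_sub_le => e e0.
have a1 : 0 < `|a| + 1 by rewrite ltr_wpDl.
have [|N N0 /ltW bN] := fejer_converges b (e := e / (`|a| + 1)).
  by rewrite divr_gt0.
set Y := (X in `|_ - X|); suff <- : fourier k (cmul a (fejer N b)) = Y.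
  rewrite (le_trans (fourier_nonexpansive _ _ _)) // -cmulBr.
  rewrite (le_trans (ler_norm_cmul _ _)) //.
  apply: (@le_trans _ _ ((`|a| + 1) * `|b - fejer N b|)).
    by rewrite ler_wpM2r // lerDl.
  by rewrite mulrC -ler_pdivlMr.
rewrite /fejer cmulZr fourierZ cmul_sumr fourier_sum (eq_bigr (fun=> Y)).
  by rewrite sumr_const card_ord -[Y *+ N]scaler_nat scalerA mulVf ?scale1r // pnatr_eq0 -lt0n.
move=> j _; rewrite cmul_sumr fourier_sum (bigD1 j) //= big1 ?addr0.
  rewrite subrr fourier_mul subr0 /Y; case: eqVneq => [-> //|kn0].
  by rewrite a0 ?cmul0l // lt_neqAle kn0.
move=> j' jj'; rewrite fourier_mul.
have [lt|le] := ltP (j%:Z - j'%:Z) 0; first by rewrite b0 // cmul0r.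
rewrite a0 ?cmul0l //; move: jj'; rewrite -(inj_eq val_inj) /= => jj'; lia.
Qed.

End Fourier.

(** * The topology of the Cuntz groupoid *)
Section GroupoidTopology.
Context {n : nat}.
Local Notation X := (path_space n).
Local Notation G := (cuntz_groupoid n).
Local Notation I := (seq 'I_n * seq 'I_n)%type.

Definition basic (u : I) : set G := cg_basic u.1 u.2.

Lemma cg_eqP (g h : G) : cg_range g = cg_range h -> cg_degree g = cg_degree h ->
  cg_source g = cg_source h -> g = h.
Proof.
case: g h => [x k y e] [x' k' y' e'] /= E1 E2 E3; subst x' k' y'.
by congr CuntzGroupoid; exact: Prop_irrelevance.
Qed.

Definition path_prefix (x : X) N : seq 'I_n := mkseq x N.
Definition path_shift (x : X) N : X := fun k => x (N + k)%N.

Lemma path_prefix_shift (x : X) N : concat (path_prefix x N) (path_shift x N) = x.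
Proof.
apply/funext => k; rewrite /concat /path_prefix /path_shift size_mkseq.
have [kN|Nk] := ltnP k N; first by rewrite nth_mkseq.
by rewrite nth_default ?size_mkseq // subnKC.
Qed.

Lemma basic_long (g : G) N : exists u (y : X),
  [/\ basic u g, (N <= size u.1)%N, (N <= size u.2)%N,
      cg_range g = concat u.1 y & cg_source g = concat u.2 y].
Proof.
have [a [b [x [gr gd gs]]]] := cg_spec g.
exists (a ++ path_prefix x N, b ++ path_prefix x N), (path_shift x N).
split => /=; rewrite ?size_cat ?size_mkseq ?leq_addl ?concat_cat ?path_prefix_shift //.
exists (path_shift x N); rewrite /= !concat_cat !path_prefix_shift !size_cat; split => //.
by rewrite gd; lia.
Qed.

Lemma basic_degree u g : basic u g -> cg_degree g = deg u.
Proof. by case=> x []. Qed.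

(** As for balls in an ultrametric space, two basic sets that meet are nested;
    this allows disjoint refinements of covers. *)
Lemma basic_nested u v g : basic u g -> basic v g ->
  basic u `<=` basic v \/ basic v `<=` basic u.
Proof.
move=> gu gv; have [uv|/ltnW vu] := leqP (size u.1) (size v.1).
  by right; exact: cg_basic_sub uv gu gv.
by left; exact: cg_basic_sub vu gv gu.
Qed.

Lemma cg_openP (P : set G) :
  open P <-> forall g, P g -> exists2 u, basic u g & basic u `<=` P.
Proof.
split=> [[D' _ <-] g [u D'u ug]|H]; first by exists u => // h uh; exists u.
exists [set u | basic u `<=` P] => //; apply/seteqP; split => g /=.
  by case=> u uP; exact: uP.
by move=> /H[u ug uP]; exists u.
Qed.

Lemma cg_nbhsP g (P : set G) : nbhs g P <-> exists2 u, basic u g & basic u `<=` P.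
Proof.
rewrite nbhsE; split.
  by case=> B [/cg_openP oB Bg] BP; have [u ug uB] := oB g Bg; exists u => // h /uB /BP.
case=> u ug uP; exists (basic u) => //; split => //.
by apply/cg_openP => h uh; exists u.
Qed.

Lemma basic_open u : open (basic u).
Proof. by apply/cg_openP => h uh; exists u. Qed.

(** A basic set with long words around a point outside cannot meet [basic u],
    being contained in it otherwise. *)
Lemma basic_closed u : closed (basic u).
Proof.
rewrite -[basic u]setCK; apply/open_closedC/cg_openP => g ng.
have [v [_ [vg uv _ _ _]]] := basic_long g (size u.1).
exists v => // h vh uh; apply: ng.
exact: (cg_basic_sub uv uh vh).
Qed.

Lemma cylinder_nbhs (x : X) N : nbhs x [set y : X | path_prefix y N = path_prefix x N].
Proof.
have H k : nbhs x [set y : X | y k = x k].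
  exact: (@proj_continuous nat (fun=> discrete_topology 'I_n) k x [set y | y = x k]).
elim: N => [|N IH]; first by apply: filterS filterT => y.
apply: filterS (filterI IH (H N)) => y [/= yN yN1].
by rewrite /path_prefix !mkseqS -!/(path_prefix _ _) yN yN1.
Qed.

Lemma path_space_compact : compact [set: X].
Proof.
have cD (k : nat) : compact [set: discrete_topology 'I_n].
  by apply: finite_compact; exact: finite_finset.
have := tychonoff cD; congr compact.
by apply/seteqP; split.
Qed.

Lemma shift_concat (a : seq 'I_n) (x : X) : path_shift (concat a x) (size a) = x.
Proof.
by apply/funext => k; rewrite /path_shift /concat nth_default ?leq_addr // addKn.
Qed.

Definition at_path u (x : X) : G :=
  CuntzGroupoid (ex_intro _ u.1 (ex_intro _ u.2 (ex_intro _ x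
    (And3 (erefl (concat u.1 x)) (erefl (deg u)) (erefl (concat u.2 x)))))).

Lemma at_path_continuous u : continuous (at_path u).
Proof.
move=> x P /cg_nbhsP [v vx vP]; apply: filterS (cylinder_nbhs x (size v.1)) => y yx.
apply: vP; have ux : basic u (at_path u x) by exists x.
have [uv|/ltnW vu] := leqP (size u.1) (size v.1); last first.
  by apply: (cg_basic_sub vu vx ux); exists y.
case: vx => z [/= vr vd vs].
have [d v1 xd] := concat_prefix uv vr.
have sd : size v.2 = (size u.2 + size d)%N.
  by move: vd; rewrite /deg v1 size_cat; lia.
have [d' v2 xd'] : exists2 d', v.2 = u.2 ++ d' & x = concat d' z.
  by apply: concat_prefix => //; rewrite sd leq_addr.
have dd' : d' = d.
  apply: (concat_inj (x := z)); last by rewrite -xd -xd'.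
  by move: sd; rewrite v2 size_cat => /addnI.
have yd : y = concat d (path_shift y (size d)).
  rewrite -[LHS](path_prefix_shift y (size d)); congr concat.
  have : path_prefix x (size d) = d.
    apply: (concat_inj (x := path_shift x (size d))); first by rewrite size_mkseq.
    by rewrite path_prefix_shift {1}xd; congr concat; rewrite xd shift_concat.
  move=> <-; have := congr1 (take (size d)) yx.
  have tk (w : X) : take (size d) (path_prefix w (size v.1)) = path_prefix w (size d).
    rewrite /path_prefix /mkseq -map_take take_iota; congr (map w (iota 0 _)).
    by apply/minn_idPl; rewrite v1 size_cat leq_addl.
  by rewrite !tk size_mkseq.
exists (path_shift y (size d)); split => /=.
- by rewrite v1 concat_cat -yd.
- by rewrite /deg v1 v2 dd' !size_cat; lia.
- by rewrite v2 dd' concat_cat -yd.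
Qed.

(** A basic set is a homeomorphic image of the path space, compact by
    Tychonoff's theorem. *)
Lemma basic_compact u : compact (basic u).
Proof.
have -> : basic u = at_path u @` setT.
  apply/seteqP; split => [g [x [gr gd gs]]|_ [x _ <-]]; last by exists x.
  by exists x => //; apply: cg_eqP => /=; rewrite ?gr ?gs ?gd.
apply: continuous_compact path_space_compact.
by apply: continuous_subspaceT; exact: at_path_continuous.
Qed.

(** Keep the maximal members of the family. *)
Lemma disjoint_refinement (s : seq I) : exists s',
  [/\ uniq s', {subset s' <= s},
      forall g u, u \in s -> basic u g -> exists2 v, v \in s' & basic v g
    & forall g u v, u \in s' -> v \in s' -> basic u g -> basic v g -> u = v].
Proof.
elim: s => [|u s [s' [us' s's cov dis]]]; first by exists [::].
have [[v vs' uv]|nuv] := pselect (exists2 v, v \in s' & basic u `<=` basic v).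
  exists s'; split => //; first by move=> w /s's ws; rewrite inE ws orbT.
  by move=> g w; rewrite inE => /orP[/eqP -> /uv vg|/cov/[apply]//]; exists v.
exists (u :: [seq v <- s' | `[< ~ basic v `<=` basic u >]]); split.
- rewrite /= filter_uniq // andbT mem_filter; apply/negP => /andP[/asboolP nuu _].
  exact: nuu.
- by move=> v; rewrite !inE mem_filter => /orP[->//|/andP[_ /s's ->]]; rewrite orbT.
- move=> g w; rewrite inE => /orP[/eqP -> ug|ws wg]; first by exists u; rewrite ?mem_head.
  have [v vs' vg] := cov g w ws wg.
  have [vu|vu] := pselect (basic v `<=` basic u).
    by exists u; [rewrite mem_head|exact: vu].
  by exists v => //; rewrite inE mem_filter vs' andbT; apply/orP; right; apply/asboolP.
- have C g v : v \in [seq v <- s' | `[< ~ basic v `<=` basic u >]] ->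
      basic u g -> basic v g -> False.
    rewrite mem_filter => /andP[/asboolP vu vs'] ug vg.
    by case: (basic_nested ug vg) => // uv; apply: nuv; exists v.
  move=> g v w; rewrite !inE => /orP[/eqP ->|vs'] /orP[/eqP ->|ws'] // vg wg.
  + by case: (C g w).
  + by case: (C g v).
  + by move: vs' ws' vg wg; rewrite !mem_filter => /andP[_ +] /andP[_]; exact: dis.
Qed.

Lemma disjoint_cover (K : set G) (Q : I -> Prop) : compact K ->
  (forall g, K g -> exists2 u, Q u & basic u g) ->
  exists s : seq I, [/\ uniq s, forall u, u \in s -> Q u,
      forall g, K g -> exists2 u, u \in s & basic u g
    & forall g u v, u \in s -> v \in s -> basic u g -> basic v g -> u = v].
Proof.
move=> cK HQ; have [[g0 Kg0]|nK] := pselect (exists g, K g); last first.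
  by exists [::]; split => // g Kg; case: nK; exists g.
(* The cover characterization of compactness is stated for pointed spaces. *)
pose T : ptopologicalType := HB.pack (cuntz_groupoid n) (isPointed.Build _ g0).
have : cover_compact (K : set T) by rewrite -compact_cover.
move=> /(_ I [set u | Q u] basic)[|g /HQ[u Qu ug]|D DQ Dcov].
- by move=> u _; exact: basic_open.
- by exists u.
have [s [us sD cov dis]] := disjoint_refinement (finmap.enum_fset D).
exists s; split => // [u /sD uD|g /Dcov [u uD ug]].
  by have := DQ u uD; rewrite inE.
by apply: cov ug.
Qed.

End GroupoidTopology.

(** * Continuous functions with compact support *)
Section Cc.
Context {R : realType} {n : nat}.
Local Notation C := (R[i]).
Local Notation G := (cuntz_groupoid n).
Local Notation I := (seq 'I_n * seq 'I_n)%type.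
Implicit Types (f : G -> C).

Lemma cg_continuousP f : continuous f <->
  forall g (e : C), 0 < e -> exists2 u, basic u g & forall h, basic u h -> `|f g - f h| < e.
Proof.
split=> [cf g e e0|H g].
  have /cvgrPdist_lt/(_ e e0) : f h @[h --> g] --> f g by exact: cf.
  by move=> /cg_nbhsP [u ug uP]; exists u.
apply/(@cvgrPdist_lt _ _ _ _ (nbhs_filter g)) => e e0; have [u ug uP] := H g e e0.
by apply/cg_nbhsP; exists u.
Qed.

(** Basic sets being compact, compact support means support in finitely many of
    them. *)
Lemma CcP f : @Cc R n f <->
  continuous f /\ exists s : seq I, forall g, f g != 0 -> exists2 u, u \in s & basic u g.
Proof.
split=> -[cf H]; split => //.
  have [|s [_ _ cov _]] := disjoint_cover (Q := fun=> True) H.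
    by move=> g _; have [u [_ [ug _ _ _ _]]] := basic_long g 0; exists u.
  by exists s => g fg; apply/cov/subset_closure.
case: H => s Hs; pose K := \big[setU/set0]_(u <- s) basic u.
have KP g : K g <-> exists2 u, u \in s & basic u g.
  rewrite /K; elim: (s) => [|u s' IH]; first by rewrite big_nil; split => // -[].
  rewrite big_cons; split => [[ug|/IH[v vs' vg]]|[v]].
  - by exists u; rewrite ?mem_head.
  - by exists v; rewrite // inE vs' orbT.
  - by rewrite inE => /orP[/eqP -> ug|vs' vg]; [left|right; apply/IH; exists v].
apply: (@subclosed_compact _ _ K); first exact: closed_closure.
  by apply: bigsetU_compact => u _; exact: basic_compact.
have cK : closed K.
  rewrite /K; elim: (s) => [|u s' IH]; first by rewrite big_nil; exact: closed0.
  by rewrite big_cons; apply: closedU => //; exact: basic_closed.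
rewrite [X in _ `<=` X](proj1 (closure_id K) cK).
by apply: closure_subset => g /Hs /KP.
Qed.
End Cc.

Section CcOperations.
Context {R : realType} {n : nat}.
Local Notation C := (R[i]).
Local Notation G := (cuntz_groupoid n).
Local Notation I := (seq 'I_n * seq 'I_n)%type.
Implicit Types (f : G -> C).
Local Notation Cc := (@Cc R n).
Local Notation cC := (real_complex R).

Lemma basic_refine u v (g : G) : basic u g -> basic v g ->
  exists2 w, basic w g & basic w `<=` basic u `&` basic v.
Proof.
move=> ug vg.
have [w [_ wg wuv]] := cg_basic_join (i := u) (j := v) Logic.I Logic.I ug vg.
by exists w.
Qed.

Lemma basic_or_not u (g : G) :
  exists2 v, basic v g & forall h, basic v h -> (h \in basic u) = (g \in basic u).
Proof.
have [ug|nug] := pselect (basic u g).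
  by exists u => // h uh; rewrite !mem_set.
have /cg_openP/(_ g nug)[v vg vu] : open (~` basic u).
  by rewrite openC; exact: basic_closed.
by exists v => // h /vu nuh; rewrite !memNset.
Qed.

Lemma Cc_scale_locally_constant (phi : G -> C) f : Cc f ->
  (forall g, exists2 u, basic u g & forall h, basic u h -> phi h = phi g) ->
  Cc (fun g => phi g * f g).
Proof.
move=> /CcP[/cg_continuousP cf [s Hs]] Hphi; apply/CcP; split; last first.
  by exists s => g; rewrite mulf_eq0 negb_or => /andP[_ /Hs].
apply/cg_continuousP => g e e0; have [u ug Hu] := Hphi g.
have p0 : 0 < `|phi g| + 1 by rewrite ltr_wpDl.
have [|v vg Hv] := cf g (e / (`|phi g| + 1)); first by rewrite divr_gt0.
have [w wg wuv] := basic_refine ug vg; exists w => // h /wuv[uh vh].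
rewrite (Hu _ uh) -mulrBr normrM; apply: (@le_lt_trans _ _ ((`|phi g| + 1) * `|f g - f h|)).
  by rewrite ler_wpM2r // lerDl.
by rewrite mulrC -ltr_pdivlMr //; exact: Hv.
Qed.

Lemma Cc_indic u : Cc (\1_(basic u)).
Proof.
apply/CcP; split; last first.
  exists [:: u] => g; rewrite indicE pnatr_eq0 eqb0 negbK => /set_mem ug.
  by exists u; rewrite ?mem_head.
apply/cg_continuousP => g e e0; have [v vg Hv] := basic_or_not u g.
by exists v => // h /Hv; rewrite !indicE => ->; rewrite subrr normr0.
Qed.

Lemma Cc_linear (c : C) f (h : G -> C) : Cc f -> Cc h -> Cc (c *: f + h).
Proof.
move=> /CcP[/cg_continuousP cf [s Hs]] /CcP[/cg_continuousP ch [t Ht]].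
apply/CcP; split; last first.
  exists (s ++ t) => g; rewrite !fctE /=.
  have [->|f0 _] := eqVneq (f g) 0; last first.
    by have [u us ug] := Hs g f0; exists u; rewrite // mem_cat us.
  rewrite scaler0 add0r => h0.
  by have [u us ug] := Ht g h0; exists u; rewrite // mem_cat us orbT.
apply/cg_continuousP => g e e0.
have p0 : 0 < `|c| + 1 by rewrite ltr_wpDl.
have [|u ug Hu] := cf g (e / 2 / (`|c| + 1)); first by rewrite divr_gt0 // half_gt0.
have [v vg Hv] := ch g (e / 2) (half_gt0 e0).
have [w wg wuv] := basic_refine ug vg; exists w => // k /wuv[uk vk].
rewrite !fctE /= opprD addrACA -scalerBr (splitr e).
apply: (le_lt_trans (ler_normD _ _)); apply: ltr_leD; last exact/ltW/Hv.
rewrite normrM; apply: (@le_lt_trans _ _ ((`|c| + 1) * `|f g - f k|)).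
  by rewrite ler_wpM2r // lerDl.
by rewrite mulrC -ltr_pdivlMr //; exact: Hu.
Qed.

Lemma Cc0 : Cc 0.
Proof.
have := @Cc_linear (-1) _ _ (Cc_indic ([::], [::])) (Cc_indic ([::], [::])).
by rewrite scaleN1r addNr.
Qed.

Lemma inv_basic (g : G) u : basic u g -> basic (u.2, u.1) (cg_inv g).
Proof. by case=> x [gr gd gs]; exists x; rewrite /= gr gd gs opprB. Qed.

Lemma cg_invK : involutive (@cg_inv n).
Proof. by move=> g; apply: cg_eqP => //=; rewrite opprK. Qed.

Lemma Cc_star f : Cc f -> Cc (conv_star f).
Proof.
move=> /CcP[/cg_continuousP cf [s Hs]]; apply/CcP; split; last first.
  exists [seq (u.2, u.1) | u <- s] => g; rewrite /conv_star conjc_eq0 => /Hs[u us ug].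
  by exists (u.2, u.1); [apply: map_f|rewrite -(cg_invK g); exact: inv_basic].
apply/cg_continuousP => g e e0; have [u ug Hu] := cf (cg_inv g) e e0.
exists (u.2, u.1); first by rewrite -(cg_invK g); exact: inv_basic.
move=> h /inv_basic; rewrite -surjective_pairing => /Hu; apply: le_lt_trans.
by rewrite /conv_star -rmorphB (norm_conjC (_ : C)).
Qed.

Lemma Cc_sqr f : Cc f -> Cc (fun g => `|f g| ^+ 2).
Proof.
move=> /CcP[/cg_continuousP cf [s Hs]]; apply/CcP; split; last first.
  by exists s => g; rewrite sqrf_eq0 normr_eq0 => /Hs.
apply/cg_continuousP => g e e0; pose M := `|f g| *+ 2 + 1.
have M0 : 0 < M by rewrite ltr_wpDl // mulrn_wge0.
have [|u ug Hu] := cf g (e / M); first by rewrite divr_gt0.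
have [v vg Hv] := cf g 1 ltr01.
have [w wg wuv] := basic_refine ug vg; exists w => // h /wuv[/Hu uh /Hv vh].
have fh : `|f h| <= `|f g| + 1.
  rewrite -[f h](subrK (f g)) addrC (le_trans (ler_normD _ _)) // lerD2l.
  by rewrite distrC ltW.
rewrite subr_sqr normrM (@ger0_norm _ (`|f g| + `|f h|)) ?addr_ge0 //.
apply: (@le_lt_trans _ _ (`|f g - f h| * M)).
  rewrite ler_pM ?addr_ge0 ?ler_dist_dist //.
  by rewrite /M mulr2n -addrA lerD2l.
by rewrite -ltr_pdivlMr.
Qed.

Lemma fsbig_single (T : choiceType) (P : set T) (F : T -> C) x : P x ->
  (forall y, P y -> y <> x -> F y = 0) -> \sum_(y \in P) F y = F x.
Proof.
move=> Px H; transitivity (\sum_(y \in [set x]) F y); last exact: fsbig_set1.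
symmetry.
apply: fsbig_widen => [y ->//|y [Py yx]]; exact: H.
Qed.

(** The element of the bisection [basic u] with the same source as [c], when
    that source begins with [u.2]. *)
Definition transport u (c : G) : G := at_path u (path_shift (cg_source c) (size u.2)).

(** In the convolution at most one factorization of [c] contributes: the second
    factor is the element of the bisection with source that of [c], and the
    first is its inverse. *)
Lemma conv_star_self u f (c : G) : (forall g, f g != 0 -> basic u g) ->
  Defs.conv (conv_star f) f c =
  if c \in basic (u.2, u.2) then `|f (transport u c)| ^+ 2 else 0.
Proof.
move=> fu; rewrite /Defs.conv.
have key p : cg_mul_to c p.1 p.2 -> conv_star f p.1 * f p.2 != 0 ->
    [/\ basic (u.2, u.2) c, p.2 = transport u c & p.1 = cg_inv (transport u c)].
  case: p => [p q] [/= pq cr cd cs]; rewrite mulf_eq0 negb_or conjc_eq0.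
  move=> /andP[/fu [z [pr pd ps]] /fu[z' [qr qd qs]]].
  have zz' : z = z'.
    move: pq; rewrite qr -[cg_source p]/(cg_range (cg_inv p)) pr => /(congr1 (path_shift^~ (size u.1))).
    by rewrite !shift_concat.
  have qE : q = transport u c.
    by apply: cg_eqP; rewrite /transport /= ?qr ?qs ?cs ?qd ?qs ?shift_concat.
  split => //.
  - exists z'; rewrite /= cs qs cr -[cg_range p]/(cg_source (cg_inv p)) ps zz'; split => //.
    by move: pd; rewrite /= cd qd => /eqP; rewrite eqr_oppLR => /eqP ->; rewrite addNr subrr.
  - rewrite -qE -(cg_invK p); congr cg_inv.
    by apply: cg_eqP; rewrite ?pr ?qr ?pd ?qd ?ps ?qs ?zz'.
case: ifPn => [/set_mem [z [cr cd cs]]|/negP nc]; last first.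
  apply: fsbig1 => p /= pc; apply/eqP; apply/negPn/negP => /(key _ pc)[uc _ _].
  by apply: nc; rewrite mem_set.
rewrite (@fsbig_single _ _ _ (cg_inv (transport u c), transport u c)).
- by rewrite /= /conv_star cg_invK normCK mulrC.
- split => //=; first by rewrite cr cs shift_concat.
  by rewrite cd addNr subrr.
  by rewrite cs shift_concat.
- move=> [p q] pc pq; apply/eqP; apply/negPn/negP => /(key _ pc)[_ /= qE pE].
  by apply: pq; rewrite pE qE.
Qed.

End CcOperations.

(** * The norm of a function carried by a bisection *)
Section BisectionNorm.
Context {R : realType} {n : nat}.
Local Notation C := (R[i]).
Local Notation G := (cuntz_groupoid n).
Local Notation I := (seq 'I_n * seq 'I_n)%type.
Implicit Types (f : G -> C).
Local Notation Cc := (@Cc R n).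
Local Notation cC := (real_complex R).

Lemma concat_nil (x : path_space n) : concat [::] x = x.
Proof. by apply/funext => k; rewrite /concat nth_nil subn0. Qed.

Definition modulus (w : C) : R := complex.Re `|w|.

Lemma modulusE (w : C) : `|w| = cC (modulus w).
Proof. by rewrite RRe_real. Qed.

Lemma modulus_ge0 w : 0 <= modulus w.
Proof. by rewrite -ler0c -modulusE. Qed.

Lemma transport_eq u (p c : G) : basic u p -> cg_source p = cg_source c ->
  transport u c = p.
Proof.
move=> [z [pr pd ps]] pc; apply: cg_eqP; rewrite /transport /= ?pr ?pd -?pc ?ps //.
  by rewrite shift_concat.
by rewrite shift_concat.
Qed.

Lemma transport_source u (c : G) : basic (u.2, u.2) c ->
  basic u (transport u c) /\ cg_source (transport u c) = cg_source c.
Proof.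
move=> [z [cr cd cs]]; split; first by exists (path_shift (cg_source c) (size u.2)).
by rewrite /transport /= cs shift_concat.
Qed.

Definition diagonal_part u f (c : G) : C :=
  if c \in basic (u.2, u.2) then f (transport u c) else 0.

(** Transport along the bisection maps the basic sets [basic (w.2, w.2)] with
    [basic w] inside [basic u] back to [basic w]. *)
Lemma Cc_diagonal_part u f : Cc f -> Cc (diagonal_part u f).
Proof.
move=> /CcP[/cg_continuousP cf [s Hs]]; apply/CcP; split; last first.
  exists [:: (u.2, u.2)] => g; rewrite /diagonal_part.
  by case: ifPn => [/set_mem ug|_ /eqP //]; exists (u.2, u.2); rewrite ?mem_head.
apply/cg_continuousP => c e e0; have [v vc Hv] := basic_or_not (u.2, u.2) c.
have [uc|nuc] := pselect (basic (u.2, u.2) c); last first.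
  by exists v => // c' /Hv; rewrite /diagonal_part => ->; rewrite memNset // subrr normr0.
have [up pc] := transport_source uc.
have [v' vp Hv'] := cf (transport u c) e e0.
have [w wp wuv] := basic_refine up vp; exists (w.2, w.2).
  have [z [pr pd ps]] := wp; case: uc => y [cr cd cs].
  by exists z; split; rewrite /= ?cd ?subrr //; rewrite -?pc ?ps // cr -cs -pc.
move=> c' wc'; have [wp' pc'] := transport_source wc'.
have [up' vp'] := wuv _ wp'.
have uc' : basic (u.2, u.2) c'.
  case: up' => y [yr yd ys]; case: wc' => z [cr cd cs].
  by exists y; split; rewrite /= ?cd ?subrr //; rewrite ?cr -?cs -pc' ys.
rewrite /diagonal_part !mem_set // (transport_eq up' pc').
exact: Hv'.
Qed.

Lemma conv_star_diagonal u f : (forall g, f g != 0 -> basic u g) ->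
  Defs.conv (conv_star f) f = fun c => `|diagonal_part u f c| ^+ 2.
Proof.
move=> fu; apply/funext => c; rewrite (conv_star_self _ fu) /diagonal_part.
by case: ifP; rewrite // normr0 expr0n.
Qed.

(** [basic unit_pair] is the set of units. *)
Definition unit_pair : I := ([::], [::]).

Definition sqrt_complement (M : R) f (c : G) : C :=
  if c \in basic unit_pair then cC (Num.sqrt (M ^+ 2 - modulus (f c) ^+ 2)) else 0.

Lemma sqrt_dist (a b : R) : 0 <= a -> 0 <= b ->
  (Num.sqrt a - Num.sqrt b) ^+ 2 <= `|a - b|.
Proof.
wlog ab : a b / b <= a => [H a0 b0|a0 b0].
  have [/H|/ltW/H] := leP b a; first exact.
  by rewrite -sqrrN opprB distrC; exact.
rewrite ger0_norm ?subr_ge0 // -[X in _ <= X - _](sqr_sqrtr a0) -[X in _ <= _ - X](sqr_sqrtr b0).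
have s0 := sqrtr_ge0 b; have ss : Num.sqrt b <= Num.sqrt a by rewrite ler_wsqrtr.
nra.
Qed.

Lemma Cc_sqrt_complement (M : R) f : 0 <= M -> Cc f -> (forall g, modulus (f g) <= M) ->
  Cc (sqrt_complement M f).
Proof.
move=> M0 /CcP[/cg_continuousP cf [s Hs]] fM; apply/CcP; split; last first.
  exists [:: unit_pair] => g; rewrite /sqrt_complement.
  by case: ifPn => [/set_mem ug|_ /eqP //]; exists unit_pair; rewrite ?mem_head.
apply/cg_continuousP => c e e0; have [v vc Hv] := basic_or_not unit_pair c.
have eE : e = cC (complex.Re e) by rewrite RRe_real // gtr0_real.
set r := complex.Re e in eE; have r0 : 0 < r by rewrite -ltcR -eE.
pose d := r ^+ 2 / (M *+ 2 + 1).
have M1 : 0 < M *+ 2 + 1 by rewrite ltr_wpDl // mulrn_wge0.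
have d0 : 0 < d by rewrite divr_gt0 // exprn_gt0.
have [|v' vc' Hv'] := cf c (cC d); first by rewrite ltcR.
have [w wc wv] := basic_refine vc vc'; exists w => // c' /wv[/Hv H1 /Hv'].
rewrite /sqrt_complement H1; case: ifP => _; last by rewrite subrr normr0.
rewrite modulusE ltcR => fcc.
have ac := modulus_ge0 (f c); have ac' := modulus_ge0 (f c').
have aM := fM c; have aM' := fM c'.
have aa : `|modulus (f c) - modulus (f c')| <= modulus (f c - f c').
  rewrite -lecR -modulusE (_ : cC `|_| = `|cC (modulus (f c) - modulus (f c'))|).
    by rewrite rmorphB /= -!modulusE ler_dist_dist.
  by rewrite normc_def /= expr0n addr0 sqrtr_sqr.
rewrite -rmorphB eE (_ : `|cC _| = cC `|Num.sqrt (M ^+ 2 - modulus (f c) ^+ 2) -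
  Num.sqrt (M ^+ 2 - modulus (f c') ^+ 2)|); last first.
  by rewrite normc_def /= expr0n addr0 sqrtr_sqr.
rewrite ltcR -(@ltr_pXn2r _ 2) ?nnegrE ?(ltW r0) // real_normK ?num_real //.
apply: (le_lt_trans (sqrt_dist _ _)); try nra.
have -> : M ^+ 2 - modulus (f c) ^+ 2 - (M ^+ 2 - modulus (f c') ^+ 2) =
  - ((modulus (f c) - modulus (f c')) * (modulus (f c) + modulus (f c'))) by ring.
rewrite normrN normrM [X in _ * X]ger0_norm ?addr_ge0 //.
apply: (@le_lt_trans _ _ (modulus (f c - f c') * (M *+ 2 + 1))); last by rewrite -ltr_pdivlMr.
by rewrite ler_pM ?addr_ge0 // mulr2n; lra.
Qed.

Lemma conv_sqrt_complement (M : R) f c : 0 <= M -> (forall g, modulus (f g) <= M) ->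
  Defs.conv (conv_star (sqrt_complement M f)) (sqrt_complement M f) c =
  if c \in basic unit_pair then cC (M ^+ 2 - modulus (f c) ^+ 2) else 0.
Proof.
move=> M0 fM; rewrite (@conv_star_self _ _ unit_pair); last first.
  by move=> g; rewrite /sqrt_complement; case: ifPn => [/set_mem //|_ /eqP].
case: ifPn => // Dc.
have -> : transport unit_pair c = c by apply: transport_eq => //; exact: set_mem.
rewrite /sqrt_complement Dc ger0_norm ?ler0c ?sqrtr_ge0 // -rmorphXn sqr_sqrtr //.
by have := fM c; have := modulus_ge0 (f c); nra.
Qed.

(** With [e] the square root of [M^2 - |f|^2] along the diagonal, the identity
    [f^* f + e^* e = M^2] holds on the units.  Applied to [xi] it gives
    [|f xi|^2 + |e xi|^2 <= M^2 |xi|^2], the units acting as a projection. *)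
Lemma representation_bound (H : completeNormedModType C) (ip : {dot H for Num.conj})
    (pi : (G -> C) -> H -> H) u f (M : R) (xi : H) :
  hilbert_product ip -> Cc_representation ip pi ->
  Cc f -> (forall g, f g != 0 -> basic u g) -> 0 <= M ->
  (forall g, `|f g| <= cC M) -> `|pi f xi| <= cC M * `|xi|.
Proof.
move=> hip [_ plin pmul pstar] Cf fu M0 fM.
have sq h : Cc h -> `|pi h xi| ^+ 2 = ip xi (pi (Defs.conv (conv_star h) h) xi).
  by move=> Ch; rewrite -hip pstar // pmul //; exact: Cc_star.
pose k := diagonal_part u f; pose e := sqrt_complement M k.
have Ck : Cc k by exact: Cc_diagonal_part.
have kM g : modulus (k g) <= M.
  rewrite -lecR -modulusE /k /diagonal_part; case: ifP => _ //.
  by rewrite normr0 ler0c.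
have Ce : Cc e by exact: Cc_sqrt_complement.
pose one : G -> C := \1_(basic unit_pair).
have Cone : Cc one by exact: Cc_indic.
have one1 : Defs.conv (conv_star one) one = one.
  apply/funext => c; rewrite (@conv_star_self _ _ unit_pair); last first.
    by move=> g; rewrite /one indicE pnatr_eq0 eqb0 negbK => /set_mem.
  rewrite /one !indicE; case: ifPn => [Dc|_ //].
  have -> : transport unit_pair c = c by apply: transport_eq => //; exact: set_mem.
  by rewrite Dc normr1 expr1n.
have eE : Defs.conv (conv_star e) e =
    (cC M) ^+ 2 *: one + ((-1) *: Defs.conv (conv_star f) f + 0).
  apply/funext => c; rewrite conv_sqrt_complement // (conv_star_diagonal fu) -/k.
  rewrite !fctE /= /one indicE addr0 scaleN1r.
  case: ifPn => Dc; first by rewrite [_ *: _]mulr1 rmorphB !rmorphXn /= -modulusE.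
  rewrite scaler0 sub0r /k /diagonal_part memNset ?normr0 ?expr0n ?oppr0 //.
  case=> z [cr cd cs]; move/negP: Dc; apply; rewrite mem_set //.
  by exists (concat u.2 z); rewrite /= cd cs cr concat_nil !subrr.
have Cff : Cc (Defs.conv (conv_star f) f).
  by rewrite (conv_star_diagonal fu); exact: Cc_sqr.
have pi0 : pi 0 xi = 0.
  have := plin (-1) one one Cone Cone xi.
  by rewrite !scaleN1r !addNr.
have eq : `|pi f xi| ^+ 2 + `|pi e xi| ^+ 2 = cC M ^+ 2 * `|pi one xi| ^+ 2.
  rewrite !sq // one1 eE plin //; last by apply: Cc_linear => //; exact: Cc0.
  rewrite plin //; last exact: Cc0.
  rewrite pi0 addr0 scaleN1r linearDr linearNr linearZr_LR /=.
  by rewrite addrCA subrr addr0 rmorphXn /= [Num.conj _]conjc_real.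
(* Expand the square of the norm of [xi - pi one xi]. *)
have one_le : `|pi one xi| ^+ 2 <= `|xi| ^+ 2.
  have E : ip xi (pi one xi) = `|pi one xi| ^+ 2 by rewrite sq // one1.
  have E' : ip (pi one xi) xi = `|pi one xi| ^+ 2.
    rewrite pstar // -E; congr (ip _ (pi _ _)); apply/funext => c.
    rewrite /conv_star /one !indicE (_ : (cg_inv c \in basic unit_pair) = (c \in basic unit_pair)).
      by case: (c \in _); rewrite ?conjc1 ?conjc0.
    by apply/idP/idP => /set_mem /inv_basic; rewrite ?cg_invK => /mem_set.
  have : 0 <= `|xi - pi one xi| ^+ 2 by rewrite exprn_ge0.
  rewrite -hip linearBl !linearBr /= !hip E E' opprB addrA subrK.
  by rewrite subr_ge0.
rewrite -(@ler_pXn2r _ 2) ?nnegrE ?mulr_ge0 ?ler0c //.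
apply: (@le_trans _ _ (`|pi f xi| ^+ 2 + `|pi e xi| ^+ 2)).
  by rewrite lerDl exprn_ge0.
by rewrite eq exprMn ler_wpM2l // exprn_ge0 // ler0c.
Qed.

Lemma groupoid_norm_bisection u f (M : R) :
  Cc f -> (forall g, f g != 0 -> basic u g) -> 0 <= M ->
  (forall g, `|f g| <= cC M) -> groupoid_norm f <= M.
Proof.
move=> Cf fu M0 fM; rewrite /groupoid_norm.
(* The supremum of the empty set is 0 by convention. *)
set E := (X in sup X); have [->|E0] := eqVneq E set0; first by rewrite sup0.
apply: ge_sup; first by apply/set0P.
move=> r [H [ip [pi [xi [hip hpi xi1 rE]]]]].
rewrite -lecR rE (le_trans (representation_bound xi hip hpi Cf fu M0 fM)) //.
by rewrite ler_piMr // ler0c.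
Qed.

End BisectionNorm.

(** * The gauge action *)
Lemma complex_cauchy_cvg (R : realType) (F : set_system R[i]) :
  ProperFilter F -> cauchy F -> cvg F.
Proof.
move=> FF /cauchyP cF; have FF' : Filter F by exact: filter_filter.
have cvg_part (p : R[i] -> R) : (forall z w, `|p z - p w|%:C%C <= `|z - w|) -> cvg (p @ F).
  move=> Hp; apply: cauchy_cvg; apply/cauchyP => e e0.
  have [|z Fz] := cF (real_complex R e); first by rewrite ltcR.
  exists (p z).
  apply: (@filterS _ F FF' (ball z (real_complex R e)) (p @^-1` ball (p z) e) _ Fz) => w; rewrite -!ball_normE /= => zw.
  by have := le_lt_trans (Hp _ _) zw; rewrite ltcR.
have [|a Fa] := (@cvg_ex _ _).1 (cvg_part (@complex.Re R) _).
  by move=> [a b] [c d]; exact: (normc_ge_Re ((a +i* b)%C - (c +i* d)%C)).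
have [|b Fb] := (@cvg_ex _ _).1 (cvg_part (@complex.Im R) _).
  move=> [a' b] [c d]; rewrite normc_def /= lecR -sqrtr_sqr ler_wsqrtr //.
  by rewrite lerDr sqr_ge0.
suff H : F --> (a +i* b)%C by exact: (cvgP _ H).
move=> B /nbhs_ballP [e /= e0 eB].
have eE : real_complex R (complex.Re e) = e by rewrite RRe_real // gtr0_real.
have r0 : 0 < complex.Re e by rewrite -ltcR eE.
have [Ba Bb] := (nbhsx_ballx a _ (half_gt0 r0), nbhsx_ballx b _ (half_gt0 r0)).
suff sub : @complex.Re R @^-1` ball a (complex.Re e / 2) `&`
    @complex.Im R @^-1` ball b (complex.Re e / 2) `<=` B.
  by apply: (filterS sub); apply: filterI; [exact: Fa|exact: Fb].
case=> c d [].
rewrite -!ball_normE /= => ac bd; apply: eB; rewrite -ball_normE /=.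
have -> : (a +i* b)%C - (c +i* d)%C = real_complex R (a - c) + 'i%C * real_complex R (b - d).
  by rewrite [LHS]complexE.
rewrite (le_lt_trans (ler_normD _ _)) // normrM.
have nr x : `|real_complex R x| = real_complex R `|x|.
  by rewrite normc_def /= expr0n addr0 sqrtr_sqr.
have ni : `|'i%C : R[i]| = 1 by rewrite normc_def /= expr0n expr1n add0r sqrtr1.
by rewrite ni mul1r !nr -rmorphD -eE ltcR (splitr (complex.Re e)) ltrD.
Qed.

(** Completeness of the complex numbers is what gives the values of
    [as_function] as limits. *)
HB.instance Definition _ (R : realType) := Uniform_isComplete.Build R[i] (@complex_cauchy_cvg R).

Section Gauge.
Context {R : realType} {n : nat}.
Local Notation C := (R[i]).
Local Notation G := (cuntz_groupoid n).
Local Notation I := (seq 'I_n * seq 'I_n)%type.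
Implicit Types (f : G -> C).
Local Notation Cc := (@Cc R n).

Definition gauge_action (z : C) f (g : G) : C := z ^ cg_degree g * f g.

Lemma Cc_gauge z f : Cc f -> Cc (gauge_action z f).
Proof.
move=> Cf; apply: Cc_scale_locally_constant => // g.
have [u [_ [ug _ _ _ _]]] := basic_long g 0; exists u => // h uh.
by rewrite (basic_degree ug) (basic_degree uh).
Qed.

(** Scaling by a nonzero constant preserves the support, so this also holds when
    the support is infinite and both sums are 0 by convention. *)
Lemma fsbig_scale (T : choiceType) (P : set T) (F : T -> C) c : c != 0 ->
  \sum_(x \in P) (c * F x) = c * \sum_(x \in P) F x.
Proof.
move=> c0; rewrite /finite_support mulr_sumr.
have -> : P `&` (fun x => c * F x) @^-1` [set~ 0] = P `&` F @^-1` [set~ 0] => //.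
apply/seteqP; split => x [Px /= /eqP Fx]; split => //=; apply/eqP; move: Fx;
  by rewrite mulf_eq0 (negbTE c0).
Qed.

Lemma gauge_conv z f (h : G -> C) : z != 0 ->
  gauge_action z (Defs.conv f h) = Defs.conv (gauge_action z f) (gauge_action z h).
Proof.
move=> z0; apply/funext => c; rewrite /gauge_action /Defs.conv -fsbig_scale; last first.
  by rewrite expfz_neq0.
apply: eq_fsbigr => p; rewrite inE => -[_ _ -> _].
by rewrite expfzDr // mulrACA.
Qed.

Lemma gauge_star z f : `|z| = 1 ->
  gauge_action z (conv_star f) = conv_star (gauge_action z f).
Proof.
move=> z1; apply/funext => c; rewrite /gauge_action /conv_star rmorphM /=.
by congr (_ * _); rewrite [RHS](conj_exprz _ z1) opprK.
Qed.

Lemma gauge_linear z (c : C) f (h : G -> C) :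
  gauge_action z (c *: f + h) = c *: gauge_action z f + gauge_action z h.
Proof.
by apply/funext => g; rewrite /gauge_action !fctE /= mulrDr; congr (_ + _); exact: mulrCA.
Qed.

(** Precomposition with the gauge action permutes the representations. *)
Lemma groupoid_norm_gauge z f : `|z| = 1 -> Cc f ->
  groupoid_norm (gauge_action z f) = groupoid_norm f.
Proof.
pose E f := [set r : R | exists (H : completeNormedModType R[i])
      (ip : {dot H for Num.conj}) (pi : (cuntz_groupoid n -> R[i]) -> H -> H)
      (xi : H),
    [/\ hilbert_product ip, Cc_representation ip pi, `|xi| <= 1
      & r%:C%C = `|pi f xi|] ].
have sub w h : `|w| = 1 -> E (gauge_action w h) `<=` E h.
  move=> w1 r [H [ip [pi [xi [hip [pb pl pm ps] xi1 rE]]]]].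
  have w0 : w != 0 by rewrite -normr_gt0 w1 ltr01.
  exists H, ip, (fun f => pi (gauge_action w f)), xi; split => //; split.
  - by move=> k Ck; apply/pb/Cc_gauge.
  - by move=> c k k' Ck Ck' x; rewrite gauge_linear pl //; exact: Cc_gauge.
  - by move=> k k' Ck Ck' x; rewrite gauge_conv // pm //; exact: Cc_gauge.
  - by move=> k Ck x y; rewrite gauge_star // ps //; exact: Cc_gauge.
move=> z1 Cf; have z0 : z != 0 by rewrite -normr_gt0 z1 ltr01.
congr (sup _); apply/seteqP; split; first exact: sub.
have {1}-> : f = gauge_action z^-1 (gauge_action z f).
  apply/funext => g; rewrite /gauge_action mulrA exprz_inv -expfzDr //.
  by rewrite addNr expr0z mul1r.
by apply: sub; rewrite normfV z1 invr1.
Qed.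

End Gauge.

(** * Combinations of monomials in the groupoid algebra *)
Section Simple.
Context {R : realType} {n : nat}.
Local Notation C := (R[i]).
Local Notation G := (cuntz_groupoid n).
Local Notation I := (seq 'I_n * seq 'I_n)%type.
Implicit Types (f : G -> C) (l : seq (C * I)).
Local Notation Cc := (@Cc R n).
Local Notation cC := (real_complex R).

Definition indicator (u : I) : G -> C := \1_(basic u).
Definition simple l : G -> C := ev indicator l.

Lemma simple_nil : simple [::] = 0. Proof. exact: big_nil. Qed.
Lemma simple_cons p l : simple (p :: l) = p.1 *: indicator p.2 + simple l.
Proof. exact: big_cons. Qed.

Lemma simpleE l g : simple l g = \sum_(p <- l) p.1 * (g \in basic p.2)%:R.
Proof.
elim: l => [|p l IH]; first by rewrite simple_nil big_nil.
rewrite simple_cons big_cons -IH -[(g \in _)%:R](indicE C).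
by [].
Qed.

Lemma Cc_simple l : Cc (simple l).
Proof.
elim: l => [|p l IH]; first by rewrite simple_nil; exact: Cc0.
by rewrite simple_cons; apply: Cc_linear => //; exact: Cc_indic.
Qed.

Lemma Cc_sub f (h : G -> C) : Cc f -> Cc h -> Cc (f - h).
Proof. by move=> Cf Ch; rewrite addrC -scaleN1r; exact: Cc_linear. Qed.

Lemma simple_gauge z l :
  simple (multiplier deg (fun d => z ^ d) l) = gauge_action z (simple l).
Proof.
apply/funext => g; rewrite /gauge_action !simpleE big_map mulr_sumr.
apply: eq_bigr => p _ /=; case: (boolP (g \in _)) => [/set_mem gp|_]; last by rewrite !mulr0.
by rewrite !mulr1 (basic_degree gp).
Qed.

End Simple.

Section GroupoidAlgebra.
Context {R : realType} {n : nat} {A : cstarAlgType R[i]}.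
Local Notation C := (R[i]).
Local Notation G := (cuntz_groupoid n).
Local Notation I := (seq 'I_n * seq 'I_n)%type.
Implicit Types (f : G -> C) (l : seq (C * I)).
Local Notation Cc := (@Cc R n).
Local Notation cC := (real_complex R).
Variables (S : 'I_n -> A) (iota : (G -> C) -> A).
Hypothesis hS : is_cuntz_algebra S.
Hypothesis hiota : is_groupoid_cstar_algebra iota.
Hypothesis hid : forall alpha beta : seq 'I_n,
  iota (\1_(cg_basic alpha beta)) =
    cmul (word_isometry S alpha) (star (word_isometry S beta)).
Local Notation m := (mono S).

Lemma iota_linear c f (h : G -> C) : Cc f -> Cc h ->
  iota (c *: f + h) = c *: iota f + iota h.
Proof. by case: hiota => H _ _ _ _; exact: H. Qed.

Lemma iota0 : iota 0 = 0.
Proof.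
by have := iota_linear (-1) Cc0 Cc0; rewrite !scaleN1r !addNr.
Qed.

Lemma iota_sub f (h : G -> C) : Cc f -> Cc h -> iota (f - h) = iota f - iota h.
Proof.
by move=> Cf Ch; rewrite addrC -scaleN1r iota_linear // scaleN1r addrC.
Qed.

Lemma iota_simple l : iota (simple l) = ev m l.
Proof.
elim: l => [|p l IH]; first by rewrite simple_nil iota0 /ev big_nil.
rewrite simple_cons iota_linear; [|exact: Cc_indic|exact: Cc_simple].
by rewrite IH /ev big_cons; congr (_ *: _ + _); exact: hid.
Qed.

Lemma iota_norm f : Cc f -> `|iota f| = cC (groupoid_norm f).
Proof. by case: hiota => _ _ _ H _; exact: H. Qed.

Lemma cuntz_iso i : cmul (star (S i)) (S i) = cone.
Proof. by case: hS. Qed.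

Lemma cuntz_sum : \sum_(i < n) cmul (S i) (star (S i)) = cone.
Proof. by case: hS. Qed.

(** Distinct generators have orthogonal ranges because the sets
    [cg_basic [:: i] [:: i]] are disjoint sets of units. *)
Lemma cuntz_orth i j : i != j -> cmul (star (S i)) (S j) = 0.
Proof.
move=> ij; have w1 k : word_isometry S [:: k] = S k by exact: big_seq1.
have C1 k : Cc (\1_(cg_basic [:: k] [:: k])) by exact: (Cc_indic ([:: k], [:: k])).
have Z : cmul (cmul (S i) (star (S i))) (cmul (S j) (star (S j))) = 0.
  rewrite -(w1 i) -(w1 j) -!hid; have [_ iM _ _ _] := hiota; rewrite -iM //.
  rewrite -[RHS]iota0; congr iota; apply/funext => c; rewrite /Defs.conv.
  apply: fsbig1 => -[p q] /= [pq _ _ _]; rewrite !indicE.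
  case: (boolP (p \in _)) => [/set_mem [x [_ _ px]]|_]; last by rewrite mul0r.
  case: (boolP (q \in _)) => [/set_mem [y [qy _ _]]|_]; last by rewrite mulr0.
  have := congr1 (fun z : path_space n => z 0%N) pq.
  by rewrite px qy /concat /= => ji; rewrite ji eqxx in ij.
transitivity (cmul (star (S i)) (cmul (cmul (cmul (S i) (star (S i)))
  (cmul (S j) (star (S j)))) (S j))); last by rewrite Z cmul0l cmul0r.
by rewrite !cmulA cuntz_iso cmul1a -!cmulA cuntz_iso cmula1.
Qed.

Definition span (a : A) := exists l, a = ev m l.

Lemma span_linear c a b : span a -> span b -> span (c *: a + b).
Proof. by move=> [l ->] [l' ->]; exists (lscale c l ++ l'); rewrite ev_cat ev_lscale. Qed.

Lemma span0 : span 0.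
Proof. by exists [::]; rewrite /ev big_nil. Qed.

Lemma span_mono u : span (m u).
Proof. by exists [:: (1, u)]; rewrite /ev big_seq1 scale1r. Qed.

Lemma span_sum J (r : seq J) (F : J -> A) : (forall j, span (F j)) ->
  span (\sum_(j <- r) F j).
Proof.
move=> HF; elim: r => [|j r IH]; first by rewrite big_nil; exact: span0.
by rewrite big_cons -[F j]scale1r; exact: span_linear.
Qed.

Lemma spanZ c a : span a -> span (c *: a).
Proof. by move=> sa; rewrite -[_ *: _]addr0; apply: span_linear => //; exact: span0. Qed.

Lemma mono_mul_cuntz u v : cmul (m u) (m v) = 0 \/
  exists2 r, cmul (m u) (m v) = m r & deg r = deg u + deg v.
Proof. exact: mono_mul cuntz_iso cuntz_orth _ _. Qed.

Lemma mono_star_cuntz u : exists2 v, star (m u) = m v & deg v = - deg u.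
Proof. by exists (u.2, u.1); [rewrite mono_star|rewrite /deg opprB]. Qed.

Lemma span_mul a b : span a -> span b -> span (cmul a b).
Proof.
move=> [l ->] [l' ->]; rewrite /ev cmul_suml; apply: span_sum => p.
rewrite cmul_sumr; apply: span_sum => q; rewrite cmulZl cmulZr.
apply/spanZ/spanZ; case: (mono_mul_cuntz p.2 q.2) => [->|[r -> _]].
  exact: span0.
exact: span_mono.
Qed.

Lemma span_star a : span a -> span (star a).
Proof.
move=> [l ->]; rewrite /ev star_sum; apply: span_sum => p; rewrite starZ.
by apply: spanZ; rewrite mono_star; exact: span_mono.
Qed.

Lemma closure_lipschitz (D E : set A) F : lipschitz_map F ->
  (forall a, D a -> closure E (F a)) -> forall a, closure D a -> closure E (F a).
Proof.
move=> [M M0 HF] DE a /closure_normP Da; apply/closure_normP => e e0.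
have M1 : 0 < M + 1 by rewrite ltr_wpDl.
have [|b Db ab] := Da (e / 2 / (M + 1)); first by rewrite divr_gt0 // half_gt0.
have /closure_normP/(_ _ (half_gt0 e0))[d Ed bd] := DE b Db.
exists d => //; rewrite (le_lt_trans (ler_distD (F b) _ _)) // (splitr e).
apply: ler_ltD => //; rewrite (le_trans (HF _ _)) //.
apply: (@le_trans _ _ ((M + 1) * `|a - b|)); first by rewrite ler_wpM2r // lerDl.
by rewrite mulrC -ler_pdivlMr // ltW.
Qed.

Lemma closure_linear (D : set A) (c : C) a b :
  (forall c a b, D a -> D b -> D (c *: a + b)) ->
  closure D a -> closure D b -> closure D (c *: a + b).
Proof.
move=> HD Da; move: b; apply: closure_lipschitz.
  by apply: lip_add; [exact: lip_cst|exact: lip_id].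
move=> b Db; move: a Da; apply: (@closure_lipschitz _ _ (fun a => c *: a + b)).
  by apply: lip_add; [exact/lip_scale/lip_id|exact: lip_cst].
by move=> a Da; apply/subset_closure/HD.
Qed.

Lemma closure_mul (D : set A) a b :
  (forall a b, D a -> D b -> D (cmul a b)) ->
  closure D a -> closure D b -> closure D (cmul a b).
Proof.
move=> HD Da; move: b; apply: closure_lipschitz; first exact/lip_mull/lip_id.
move=> b Db; move: a Da; apply: (@closure_lipschitz _ _ (fun a => cmul a b)).
  exact/lip_mulr/lip_id.
by move=> a Da; apply/subset_closure/HD.
Qed.

(** The closure of the span of the monomials is a closed self-adjoint subalgebra
    that contains the generators. *)
Lemma span_dense a (e : C) : 0 < e -> exists l, `|a - ev m l| < e.
Proof.
suff /closure_normP H : closure span a by move=> /H[_ [l ->]]; exists l.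
have [_ _ gen] := hS; suff -> : closure span = setT by [].
have Cmono u : closure span (m u) by apply/subset_closure/span_mono.
apply: gen => [||i].
- split; [exact: closed_closure|exact/subset_closure/span0| |].
  + by move=> c b b'; apply: closure_linear; exact: span_linear.
  + by move=> b b'; apply: closure_mul; exact: span_mul.
- apply: closure_lipschitz; first exact/lip_star/lip_id.
  by move=> b sb; exact/subset_closure/span_star.
- have -> : S i = m ([:: i], [::]).
    by rewrite /mono /= word_nil star1 cmula1 /word_isometry big_seq1.
  exact: Cmono.
Qed.

Lemma gauge_isometric (z : C) l : `|z| = 1 ->
  `|ev m (multiplier deg (fun d => z ^ d) l)| <= `|ev m l|.
Proof.
move=> z1; rewrite -!iota_simple simple_gauge !iota_norm.
- by rewrite groupoid_norm_gauge //; exact: Cc_simple.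
- exact: Cc_simple.
- by apply: Cc_gauge; exact: Cc_simple.
Qed.

(** Approximation of a function carried by one bisection: the difference with
    a simple function carried by the same bisection is uniformly small, hence
    small in the algebra. *)
Lemma approx_bisection u f (e : C) : Cc f -> (forall g, f g != 0 -> basic u g) ->
  0 < e -> exists l, (forall g, `|f g - simple l g| <= e) /\ `|iota f - ev m l| <= e.
Proof.
move=> Cf fu e0; have [cf cK] := Cf; have /cg_continuousP cf' := cf.
pose Q v := basic v `<=` basic u /\ exists c, forall h, basic v h -> `|f h - c| <= e.
have Ku : closure [set g | f g != 0] `<=` basic u.
  rewrite [X in _ `<=` X](proj1 (closure_id _) (@basic_closed _ u)).
  by apply: closure_subset => g /fu.
have [|s [us sQ cov dis]] := disjoint_cover (Q := Q) cK.
  move=> g /Ku ug; have [v vg Hv] := cf' g e e0.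
  have [w wg wuv] := basic_refine ug vg; exists w => //; split.
    by move=> h /wuv [].
  by exists (f g) => h /wuv[_ /Hv fgh]; rewrite distrC ltW.
pose c v := get [set c : C | forall h, basic v h -> `|f h - c| <= e].
have cP v : v \in s -> forall h, basic v h -> `|f h - c v| <= e.
  by move=> /sQ[_ H]; exact: (getPex H).
pose l := [seq (c v, v) | v <- s].
have lE g v : v \in s -> basic v g -> simple l g = c v.
  move=> vs vg; rewrite simpleE big_map (bigD1_seq v) //= mem_set // mulr1.
  rewrite big_seq_cond big1 ?addr0 // => w /andP[ws wv].
  case: (boolP (g \in _)) => [/set_mem wg|_]; last by rewrite mulr0.
  by rewrite (dis g w v) // eqxx in wv.
have l0 g : ~ (exists2 v, v \in s & basic v g) -> simple l g = 0.
  move=> ng; rewrite simpleE big_map big_seq big1 // => v vs /=.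
  case: (boolP (g \in _)) => [/set_mem vg|_]; last by rewrite mulr0.
  by case: ng; exists v.
have f0 g : ~ (exists2 v, v \in s & basic v g) -> f g = 0.
  by move=> ng; apply/eqP/negPn/negP => fg; apply/ng/cov/subset_closure.
have fl g : `|f g - simple l g| <= e.
  have [[v vs vg]|ng] := pselect (exists2 v, v \in s & basic v g).
    by rewrite (lE _ _ vs vg) cP.
  by rewrite f0 // l0 // subrr normr0 ltW.
have Cd : Cc (f - simple l).
  exact: Cc_sub Cf (Cc_simple l).
exists l; split; first exact: fl.
rewrite -iota_simple -(iota_sub Cf (Cc_simple l)) (iota_norm Cd).
have eE : cC (complex.Re e) = e by rewrite RRe_real // gtr0_real.
rewrite -eE lecR; apply: (@groupoid_norm_bisection _ _ u _ _ Cd).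
- move=> g; have [[v vs vg] _|ng] := pselect (exists2 v, v \in s & basic v g).
    by have [vu _] := sQ v vs; exact: vu.
  by rewrite !fctE f0 // l0 // subrr eqxx.
- by rewrite -lecR eE ltW.
- by move=> g; rewrite eE; exact: fl.
Qed.

(** Cut [f] into finitely many pieces carried by disjoint bisections. *)
Lemma approx_Cc f (e : C) : Cc f -> 0 < e ->
  exists l, (forall g, `|f g - simple l g| <= e) /\ `|iota f - ev m l| <= e.
Proof.
move=> Cf; have [_ cK] := Cf.
have [|s [us _ cov dis]] := disjoint_cover (Q := fun=> True) cK.
  by move=> g _; have [u [_ [ug _ _ _ _]]] := basic_long g 0; exists u.
pose fu u g : C := indicator u g * f g.
have fuE u g : fu u g = (g \in basic u)%:R * f g by rewrite /fu /indicator indicE.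
have Cfu u : Cc (fu u).
  apply: Cc_scale_locally_constant => // g; have [v vg Hv] := basic_or_not u g.
  by exists v => // h /Hv; rewrite /indicator !indicE => ->.
have -> : f = \sum_(u <- s) fu u.
  apply/funext => g; rewrite fct_sumE.
  have [[v vs vg]|ng] := pselect (exists2 v, v \in s & basic v g).
    rewrite (bigD1_seq v) //= big_seq_cond big1 ?addr0.
      by rewrite fuE mem_set // mul1r.
    move=> w /andP[ws wv]; rewrite fuE; case: (boolP (g \in _)) => [/set_mem wg|_]; last by rewrite mul0r.
    by rewrite (dis g w v) // eqxx in wv.
  rewrite big_seq big1 => [|v vs].
    by apply/eqP/negPn/negP => fg; apply/ng/cov/subset_closure.
  by rewrite fuE; case: (boolP (g \in _)) => [/set_mem vg|_]; [case: ng; exists v|rewrite mul0r].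
pose P (h : G -> C) := Cc h /\ forall e : C, 0 < e ->
  exists l, (forall g, `|h g - simple l g| <= e) /\ `|iota h - ev m l| <= e.
suff [_ H] : P (\sum_(u <- s) fu u) by exact: H.
apply: (big_ind P).
- split; first exact: Cc0.
  move=> d d0; exists [::]; rewrite iota0 /ev big_nil subrr normr0; split; last exact: ltW.
  by move=> g; rewrite simple_nil subrr normr0 ltW.
- move=> h h' [Ch Hh] [Ch' Hh']; split.
    by rewrite -[h]scale1r; exact: Cc_linear.
  move=> d /half_gt0 d0; have [l [lg lA]] := Hh _ d0; have [l' [lg' lA']] := Hh' _ d0.
  exists (l ++ l'); split => [g|].
    rewrite /simple ev_cat (splitr d) (_ : _ - _ = (h g - simple l g) + (h' g - simple l' g)).
      by rewrite (le_trans (ler_normD _ _)) // lerD.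
    by rewrite opprD addrACA.
  have -> : iota (h + h') = iota h + iota h'.
    by rewrite -[h]scale1r iota_linear // !scale1r.
  rewrite ev_cat opprD addrACA (splitr d).
  by rewrite (le_trans (ler_normD _ _)) // lerD.
- move=> u _; split => // d d0; apply: (approx_bisection (u := u)) => // g.
  by rewrite fuE; case: (boolP (g \in _)) => [/set_mem //|_]; rewrite mul0r eqxx.
Qed.

Local Notation W := (word_isometry S).

(** The value at [g] of a combination is a matrix entry of its part of the same
    degree, at any two words that begin the range and the source of [g], with a
    common tail, and are long enough. *)
Lemma simple_coef l mu nu (y : path_space n) (g : G) :
  cg_range g = concat mu y -> cg_source g = concat nu y ->
  cg_degree g = deg (mu, nu) ->
  (forall p, p \in l -> (size p.2.1 <= size mu)%N) ->
  cmul (star (W mu)) (cmul (ev m (multiplier deg (delta (cg_degree g)) l)) (W nu)) =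
  simple l g *: cone.
Proof.
move=> gr gs gd lmu; rewrite ev_multiplier simpleE scaler_suml cmul_suml cmul_sumr.
apply: eq_big_seq => p /lmu pmu; rewrite !cmulZl !cmulZr /delta.
have [pg|pg] := eqVneq (deg p.2) (cg_degree g).
  rewrite (mono_coef cuntz_iso cuntz_orth gr gs gd) // ?pg //.
  by rewrite scale1r indicE scalerA.
rewrite scale0r; case: (boolP (g \in _)) => [/set_mem gp|_]; last by rewrite mulr0 scale0r.
by have pk := basic_degree gp; rewrite -pk eqxx in pg.
Qed.

Hypothesis cone_neq0 : (cone : A) != 0.

Lemma simple_le l g : `|simple l g| <= `|ev m l|.
Proof.
have [N HN] := seq_bound (fun p => size p.2.1) l.
have [u [y [ug uN _ gr gs]]] := basic_long g N.
have gd : cg_degree g = deg (u.1, u.2) by rewrite (basic_degree ug).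
have := simple_coef gr gs gd (fun p pl => leq_trans (HN p pl) uN).
move=> /(congr1 Num.norm); rewrite normrZ norm_cone // mulr1 => <-.
apply: le_trans (delta_contract gauge_isometric (cg_degree g) l).
apply: le_trans (norm_mul_le1l _ (word_star_norm cuntz_iso _)) _.
exact: norm_mul_le1r (word_norm cuntz_iso _).
Qed.

(** The sup norm is dominated by the C*-norm: known for combinations of
    monomials, this passes to limits that are both uniform and in norm. *)
Lemma Cc_sup_le f g : Cc f -> `|f g| <= `|iota f|.
Proof.
move=> Cf; apply/ler_addgt0Pr => e e0.
have [l [lf lA]] := approx_Cc Cf (half_gt0 e0).
rewrite -[f g](subrK (simple l g)) (le_trans (ler_normD _ _)) //.
rewrite [X in _ <= _ + X](splitr e) addrA [leLHS]addrC.
rewrite lerD //.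
apply: (le_trans (simple_le _ _)); rewrite -[ev m l](subKr (iota f)).
by rewrite (le_trans (ler_normB _ _)) // lerD2l.
Qed.

(** The evaluations at [g] of elements of Cc near [a] form a Cauchy system; its
    limit is the value selected by [as_function]. *)
Lemma as_function_close a f g : Cc f -> `|f g - as_function iota a g| <= `|iota f - a|.
Proof.
have Cf_sub (f' f'' : G -> C) : Cc f' -> Cc f'' -> `|f' g - f'' g| <= `|iota f' - iota f''|.
  move=> C1 C2; rewrite -iota_sub //; apply: (@Cc_sup_le (f' - f'') g).
  exact: Cc_sub.
have [|L HL] := @nonexpansive_limit C _ A R[i] (ev m) (fun l => simple l g) a (@span_dense a).
  by move=> l l'; rewrite -!iota_simple; exact: Cf_sub (Cc_simple _) (Cc_simple _).
have HLf f' : Cc f' -> `|f' g - L| <= `|iota f' - a|.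
  move=> Cf; apply/ler_addgt0Pr => e e0; have [l al] := span_dense a (half_gt0 e0).
  rewrite (le_trans (ler_distD (simple l g) _ _)) // (splitr e) addrA lerD //.
    rewrite (le_trans (Cf_sub _ _ Cf (Cc_simple _))) // iota_simple.
    by rewrite (le_trans (ler_distD a _ _)) // lerD2l ltW.
  by rewrite distrC (le_trans (HL _)) // ltW.
have Lset : [set z : C | forall f : nat -> G -> C,
    (forall k, Cc (f k)) -> iota (f k) @[k --> \oo] --> a ->
    f k g @[k --> \oo] --> z] L.
  move=> F CF Fa; apply/cvgrPdist_le => e e0.
  have /cvgrPdist_le/(_ e e0) := Fa; apply: filterS => k ak.
  by rewrite distrC (le_trans (HLf _ (CF k))) // distrC.
have /getPex Hget : exists z, [set z : C | forall f : nat -> G -> C,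
    (forall k, Cc (f k)) -> iota (f k) @[k --> \oo] --> a ->
    f k g @[k --> \oo] --> z] z by exists L.
suff -> : as_function iota a g = L by exact: HLf.
have Npos k : 0 < k.+1%:R^-1 :> C by rewrite invr_gt0 ltr0n.
have [ll Hll] := choice (fun k => span_dense a (Npos k)).
have lla : iota (simple (ll k)) @[k --> \oo] --> a.
  apply/cvgrPdist_lt => e e0; have [N HN] := complex_archi e0.
  exists N => // k /= Nk; rewrite iota_simple (lt_trans (Hll k)) // (le_lt_trans _ HN) //.
  by rewrite lef_pV2 ?posrE ?ltr0n // ler_nat.
have C1 := Hget _ (fun k => Cc_simple (ll k)) lla.
have C2 := Lset _ (fun k => Cc_simple (ll k)) lla.
apply: eq_of_norm_sub_le => e e0.
have /cvgrPdist_lt/(_ _ (half_gt0 e0)) E1 := C1.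
have /cvgrPdist_lt/(_ _ (half_gt0 e0)) E2 := C2.
have [k [/= K1 K2]] := filter_ex (filterI E1 E2).
rewrite (le_trans (ler_distD (simple (ll k) g) _ _)) // (splitr e) lerD ?(ltW K1) //.
by rewrite distrC ltW.
Qed.
End GroupoidAlgebra.

(** * Fourier coefficients are determined by functions *)
Section Faithful.
Context {R : realType} {n : nat} {A : cstarAlgType R[i]}.
Local Notation C := (R[i]).
Local Notation G := (cuntz_groupoid n).
Local Notation I := (seq 'I_n * seq 'I_n)%type.
Variables (S : 'I_n -> A) (iota : (G -> C) -> A).
Hypothesis hS : is_cuntz_algebra S.
Hypothesis hiota : is_groupoid_cstar_algebra iota.
Hypothesis hid : forall alpha beta : seq 'I_n,
  iota (\1_(cg_basic alpha beta)) =
    cmul (word_isometry S alpha) (star (word_isometry S beta)).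
Hypothesis cone_neq0 : (cone : A) != 0.
Variable i0 : 'I_n.
Local Notation m := (mono S).
Local Notation W := (word_isometry S).
Local Notation Phi := (fourier deg m).

Let dense := span_dense hS hiota hid.
Let gauge := gauge_isometric hiota hid.
Let iso := cuntz_iso hS.
Let orth := cuntz_orth hS hiota hid.

(** Take a combination [l0] near [a], and lengths [p], [q] with [p - q = k] that
    bound its words.  For a much better approximation [l], append to the words
    of length [p] and [q] a word [w] that is long compared with [l].  The
    compression fixes the degree [k] part of [l0]; its entries on that of [l]
    are values of the function of [l], small because the function of [a]
    vanishes there.  So the degree [k] part of [l0] is small. *)
Lemma fourier_faithful k a :
  (forall g, cg_degree g = k -> as_function iota a g = 0) -> Phi k a = 0.
Proof.
move=> a0; apply: eq_of_norm_sub_le => e e0; have e4 := half_gt0 (half_gt0 e0).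
have [l0 /ltW al0] := dense a e4; have [M HM] := seq_bound (fun p => size p.2.1) l0.
pose L0 := ev m (multiplier deg (delta k) l0).
pose p := (M + `|k|)%N; pose q := `|p%:Z - k|%N.
have pq : p%:Z - q%:Z = k by rewrite /q /p; lia.
pose N := (size (words p : seq (seq 'I_n)) * size (words q : seq (seq 'I_n)))%N.
have [|l all'] := dense a (e := e / 2 / 2 / N.+1%:R).
  by rewrite divr_gt0 // ltr0n.
have [Lw HL] := seq_bound (fun p => size p.2.1) l.
(* Along a constant path the appended word does not move the end point, so the
   entries are taken at the same groupoid elements for all lengths. *)
pose w := nseq Lw i0; pose x0 : path_space n := fun=> i0.
have wx : concat w x0 = x0.
  by apply/funext => j; rewrite /concat nth_nseq; case: ltnP.
(* Used with [mu] empty and with [mu] equal to [w]. *)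
have entry l' al be mu : size al = p -> size be = q -> concat mu x0 = x0 ->
    (forall r, r \in l' -> (size r.2.1 <= p + size mu)%N) ->
    cmul (star (W (al ++ mu))) (cmul (ev m (multiplier deg (delta k) l')) (W (be ++ mu))) =
    simple l' (at_path (al, be) x0) *: cone.
  move=> sa sb mux Hl'; have gk : cg_degree (at_path (al, be) x0) = k.
    by rewrite /= /deg /= sa sb.
  rewrite -{1}gk (simple_coef hS hiota hid (mu := al ++ mu) (nu := be ++ mu) (y := x0)) //=.
  - by rewrite concat_cat mux.
  - by rewrite concat_cat mux.
  - by rewrite /deg /= !size_cat; lia.
  - by move=> r /Hl'; rewrite size_cat sa.
have L0fix : compress S p q w L0 = L0.
  apply: (matrix_units_eq (cuntz_sum hS) (p := p) (q := q)) => al be sa sb.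
  rewrite (compress_entry iso orth) // entry //; last first.
    by move=> r /HM rM; rewrite /p -addnA (leq_trans rM) // leq_addr.
  rewrite -{2}(cats0 al) -{2}(cats0 be) entry //; first exact: concat_nil.
  by move=> r /HM rM; rewrite /p -addnA (leq_trans rM) // leq_addr.
have small : `|compress S p q w (ev m (multiplier deg (delta k) l))| <= (e / 2 / 2 / N.+1%:R) *+ N.
  apply: (matrix_units_norm iso (cuntz_sum hS)) => al be sa sb.
  rewrite (compress_entry iso orth) // entry //; last first.
    by move=> r /HL rL; rewrite size_nseq (leq_trans rL) // leq_addl.
  rewrite normrZ norm_cone // mulr1.
  have gk : cg_degree (at_path (al, be) x0) = k by rewrite /= /deg /= sa sb.
  have := as_function_close hS hiota hid cone_neq0 a (at_path (al, be) x0) (@Cc_simple R n l).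
  rewrite a0 // subr0 (iota_simple hiota hid) => /le_trans; apply.
  by rewrite distrC ltW.
have L0le : `|L0| <= e / 2.
  rewrite -[L0]L0fix -[compress _ _ _ _ L0](subrK (compress S p q w (ev m (multiplier deg (delta k) l)))).
  rewrite (le_trans (ler_normD _ _)) // (le_trans (lerD (lexx _) small)) //.
  rewrite -compressB (le_trans (lerD (compress_norm iso orth (cuntz_sum hS) _ _ _ _) (lexx _))) //.
  rewrite /L0 ev_multiplierB (le_trans (lerD (delta_contract gauge _ _) (lexx _))) //.
  rewrite -evB (le_trans (lerD (ler_distD a _ _) (lexx _))) //.
  rewrite distrC -addrA [leRHS](splitr (e / 2)) lerD //.
  apply: (@le_trans _ _ (e / 2 / 2 / N.+1%:R + e / 2 / 2 / N.+1%:R *+ N)).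
    by rewrite lerD2r ltW.
  by rewrite -mulrS -[_ *+ _]mulr_natr divfK // pnatr_eq0.
rewrite subr0 -[Phi k a](subrK L0) (le_trans (ler_normD _ _)) // (splitr e) lerD //.
rewrite (le_trans (fourierP dense gauge _ _ _)) // (le_trans al0) //.
by rewrite ler_pdivrMr // ler_pMr ?half_gt0 // ler1n.
Qed.

End Faithful.

(** * The analytic extension of a triangular subalgebra *)
Section Extension.
Context {R : realType} {n : nat} {A : cstarAlgType R[i]}.
Local Notation C := (R[i]).
Local Notation G := (cuntz_groupoid n).
Variables (S : 'I_n -> A) (iota : (G -> C) -> A).
Hypothesis hS : is_cuntz_algebra S.
Hypothesis hiota : is_groupoid_cstar_algebra iota.
Hypothesis hid : forall alpha beta : seq 'I_n,
  iota (\1_(cg_basic alpha beta)) =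
    cmul (word_isometry S alpha) (star (word_isometry S beta)).
Hypothesis cone_neq0 : (cone : A) != 0.
Variable i0 : 'I_n.
Local Notation m := (mono S).
Local Notation Phi := (fourier deg m).

Let dense := span_dense hS hiota hid.
Let gauge := gauge_isometric hiota hid.
Let mulm := mono_mul_cuntz hS hiota hid.
Let starm := mono_star_cuntz S.
Let archi := @complex_archi R.

Lemma fourier_UHF k a : supported_in iota (@P_UHF n) a -> k != 0 -> Phi k a = 0.
Proof.
move=> aP k0; apply: (fourier_faithful hS hiota hid cone_neq0 i0) => g gk.
by apply: aP => /= gk0; rewrite -gk gk0 eqxx in k0.
Qed.

Lemma UHF_fixed a : supported_in iota (@P_UHF n) a -> Phi 0 a = a.
Proof.
by move=> aP; apply: (fourier_only_zero dense gauge archi) => k; exact: fourier_UHF.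
Qed.

Lemma fourier0_UHF a : supported_in iota (@P_UHF n) (Phi 0 a).
Proof.
move=> g g0; apply: eq_of_norm_sub_le => e e0; have [l /ltW al] := dense a e0.
have := as_function_close hS hiota hid cone_neq0 (Phi 0 a) g
  (Cc_simple (multiplier deg (delta 0) l)).
rewrite (iota_simple hiota hid) [X in X - _](_ : _ = 0).
  rewrite distrC => /le_trans; apply; rewrite distrC.
  by rewrite (le_trans (fourierP dense gauge _ _ _)).
rewrite simpleE big_map big1 // => p _ /=.
case: (boolP (g \in _)) => [/set_mem gp|_]; last by rewrite mulr0.
rewrite /delta; case: eqP => [d0|_]; last by rewrite !mul0r.
by case: g0; rewrite /P_UHF /= (basic_degree gp).
Qed.

Definition analytic_extension (T : set A) : set A :=
  [set a | (forall k, k < 0 -> Phi k a = 0) /\ T (Phi 0 a)].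

Variable T : set A.
Hypothesis hT : strongly_maximal_triangular
  (supported_in iota (@P_UHF n)) (supported_in iota (@D_0 n)) T.
Local Notation T' := (analytic_extension T).

Lemma T_UHF a : T a -> supported_in iota (@P_UHF n) a.
Proof. by case: hT => -[_ + _] _; apply. Qed.

Lemma T_closed_subalgebra : closed_subalgebra T.
Proof. by case: hT => -[]. Qed.

Lemma T_diagonal : T `&` (@star _ A @` T) = supported_in iota (@D_0 n).
Proof. by case: hT => -[]. Qed.

Lemma sub_analytic_extension : T `<=` T'.
Proof.
move=> a Ta; have aP := T_UHF Ta; split; last by rewrite (UHF_fixed aP).
by move=> k k0; apply: fourier_UHF => //; rewrite lt_eqF.
Qed.

Lemma analytic_extension_closed_subalgebra : closed_subalgebra T'.
Proof.
have [cT T0 Tlin Tmul] := T_closed_subalgebra.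
have [[f0 fl] fn] := (fourier0 dense gauge, fourier_linear dense gauge,
  fourier_nonexpansive dense gauge).
split.
- apply/closed_normP => a Ha; split.
    move=> k k0; apply: eq_of_norm_sub_le => e /Ha[b [b0 _] ab].
    by rewrite -(b0 k k0) (le_trans (fn _ _ _)) // ltW.
  move/closed_normP: cT; apply => e /Ha[b [_ Tb] ab].
  by exists (Phi 0 b) => //; rewrite (le_lt_trans (fn _ _ _)).
- by split; [move=> k _|]; rewrite f0.
- move=> c a b [a0 Ta] [b0 Tb]; split; last by rewrite fl; exact: Tlin.
  by move=> k k0; rewrite fl a0 // b0 // scaler0 addr0.
- move=> a b [a0 Ta] [b0 Tb].
  have M k := fourier_mul_analytic dense gauge mulm archi (k := k) a0 b0.
  split=> [k k0|]; first by rewrite M ?ltW // lt_eqF.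
  by rewrite M //; exact: Tmul.
Qed.

Lemma analytic_extension_diagonal :
  T' `&` (@star _ A @` T') = supported_in iota (@D_0 n).
Proof.
have fs := fourier_star dense gauge starm.
have fz := fourier_only_zero dense gauge archi.
rewrite -T_diagonal; apply/seteqP; split.
  move=> a [[a0 Ta] [b [b0 Tb] ba]].
  have aE : Phi 0 a = a.
    apply: fz => k; rewrite neq_lt => /orP[/a0 //|k0].
    by rewrite -ba fs b0 ?star0 // oppr_lt0.
  have bE : Phi 0 b = b.
    apply: fz => k; rewrite neq_lt => /orP[/b0 //|k0].
    by rewrite -[b]starK ba fs a0 ?star0 // oppr_lt0.
  by split; [rewrite -aE|exists b => //; rewrite -bE].
move=> a [Ta [b Tb ba]]; split; first exact: sub_analytic_extension.
by exists b => //; exact: sub_analytic_extension.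
Qed.

Lemma analytic_extension_dense :
  [set: A] `<=` closure [set c | exists a b, [/\ T' a, T' b & c = a + star b]].
Proof.
have [_ T'0 T'lin _] := analytic_extension_closed_subalgebra.
have [[f0 ff] fs] := (fourier0 dense gauge, fourier_fourier dense gauge,
  fourier_star dense gauge starm).
set E := (X in closure X).
have Elin c a b : E a -> E b -> E (c *: a + b).
  move=> [x [y [Tx Ty ->]]] [x' [y' [Tx' Ty' ->]]].
  exists (c *: x + x'), (Num.conj c *: y + y'); split; try exact: T'lin.
  by rewrite starD starZ conjCK scalerDr addrACA.
have E0 : closure E 0.
  by apply: subset_closure; exists 0, 0; split => //; rewrite star0 addr0.
have T'_pos k a : 0 < k -> T' (Phi k a).
  move=> k0; split; last first.
    by rewrite ff lt_eqF //; have [_] := T_closed_subalgebra.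
  by move=> j j0; rewrite ff lt_eqF // (lt_trans j0).
have EPhi k a : closure E (Phi k a).
  have [k0|k0|->] := ltgtP k 0.
  - apply: subset_closure; exists 0, (Phi (- k) (star a)); split => //.
      by apply: T'_pos; rewrite oppr_gt0.
    by rewrite add0r -fs starK.
  - apply: subset_closure; exists (Phi k a), 0; split => //; first exact: T'_pos.
    by rewrite star0 addr0.
  - have [_ Tdense] := hT; apply: closure_subset (Tdense _ (fourier0_UHF a)).
    move=> _ [x [y [Tx Ty ->]]]; exists x, y; split => //; exact: sub_analytic_extension.
have cElin c a b : closure E a -> closure E b -> closure E (c *: a + b).
  exact: closure_linear.
have Esum J (r : seq J) (F : J -> A) : (forall j, closure E (F j)) ->
    closure E (\sum_(j <- r) F j).
  move=> HF; elim: r => [|j r IH]; first by rewrite big_nil.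
  by rewrite big_cons -[F j]scale1r; exact: cElin.
move=> a _; have /closed_normP := @closed_closure _ E; apply => e e0.
have [N N0 aN] := fejer_converges dense gauge archi a e0.
exists (fejer deg m N a) => //; rewrite /fejer -[_ *: _]addr0.
by apply: cElin => //; apply: (Esum) => j; apply: (Esum) => j'; exact: EPhi.
Qed.

End Extension.

Theorem mainTheorem4 (R : realType) (n : nat) (hn : (2 <= n)%N)
    (A : cstarAlgType R[i])
    (S : 'I_n -> A) (hS : is_cuntz_algebra S)
    (iota : (cuntz_groupoid n -> R[i]) -> A)
    (hiota : is_groupoid_cstar_algebra iota)
    (hid : forall alpha beta : seq 'I_n,
       iota (\1_(cg_basic alpha beta)) =
         cmul (word_isometry S alpha) (star (word_isometry S beta)))
    (T : set A)
    (hT : strongly_maximal_triangular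
            (supported_in iota (@P_UHF n)) (supported_in iota (@D_0 n)) T) :
  exists T' : set A,
    strongly_maximal_triangular [set: A] (supported_in iota (@D_0 n)) T' /\
    T `<=` T'.
Proof.
(* The axioms admit the zero algebra, in which [T] itself is an answer. *)
have [A0|cone_neq0] := eqVneq (cone : A) 0.
  have all0 (a : A) : a = 0 by rewrite -[a]cmul1a A0 cmul0l.
  exists T; split => //; have [[Tsub _ TD] _] := hT.
  have [_ T0 _ _] := Tsub.
  split; first by split.
  by move=> a _; apply: subset_closure; exists 0, 0; split => //; rewrite [LHS]all0 [RHS]all0.
have i0 : 'I_n := Ordinal (ltnW hn).
exists (analytic_extension S T); split; last first.
  exact: (sub_analytic_extension hS hiota hid cone_neq0 i0 hT).
split; first split => //.
- exact: (analytic_extension_closed_subalgebra hS hiota hid hT).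
- exact: (analytic_extension_diagonal hS hiota hid cone_neq0 i0 hT).
- exact: (analytic_extension_dense hS hiota hid cone_neq0 i0 hT).
Qed.
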